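(* Suppose that $\mathrm{zer}(\Phi)\neq\emptyset$, $\Phi$ is $\rho$-co-hypomonotone, and $F$ is $L$-Lipschitz continuous. Fix $r>2$, $\mu>1$, $\epsilon\ge0$, $\hat\epsilon\ge0$, $\kappa\ge0$, and $$0\le\hat\kappa<\frac{3r-1}{3r(12+3r+\hat\epsilon)}.$$ Let $$\Psi:=\frac{1}{\sqrt{4+12\kappa+3\kappa r+\kappa\hat\epsilon}}\Big[1-\frac1{3r}-\hat\kappa(12+3r+\hat\epsilon)\Big]\in(0,1],$$ and suppose that $L\rho<\frac{(r-2)\Psi}{8(r+\mu-1)}$. Choose $$t_k:=k+t_0,\qquad\beta:=8\rho+2\epsilon,\qquad\frac{(r+\mu-1)\beta}{r-2}\le\eta<\bar\eta:=\frac{\Psi}{L},$$ where $t_0$ is defined in the context. Let $\{(x^k,y^k)\}$ be generated by the scheme (GAEG$_+$) described in the context with these parameters and with $u^0=Fx^0$ and directions $u^k$ satisfying, for all $k\ge1$, $$\|Fx^k-u^k\|^2\le\kappa\|Fx^k-Fy^{k-1}\|^2+\hat\kappa\|d^{k-1}\|^2.$$ Assume in addition that $T$ is closed (i.e. $\mathrm{gra}(T)$ is closed). Then both $\{x^k\}$ and $\{y^k\}$ converge to a point $x^\star\in\mathrm{zer}(\Phi)$.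
   Context: $\mathbb R^p$ carries the standard inner product and Euclidean norm. $F:\mathbb R^p\to\mathbb R^p$ is single-valued, $T:\mathbb R^p\rightrightarrows2^{\mathbb R^p}$ is set-valued, $\Phi:=F+T$, $\mathrm{zer}(\Phi)=\{x:0\in Fx+Tx\}$. For $\rho\ge0$, $\Phi$ is $\rho$-co-hypomonotone if $\langle u-v,x-y\rangle\ge-\rho\|u-v\|^2$ for all $(x,u),(y,v)\in\mathrm{gra}(\Phi)$. $F$ is $L$-Lipschitz continuous if $\|Fx-Fy\|\le L\|x-y\|$ for all $x,y$. The resolvent $J_{\eta T}$, $J_{\eta T}x=\{y:x\in y+\eta Ty\}$, is assumed to be defined on all of $\mathbb R^p$ and single-valued. Throughout $\eta>\beta\ge0$. Scheme (GAEG$_+$): start from $x^0\in\mathrm{dom}(\Phi)$, $\xi^0\in Tx^0$, $u^0:=Fx^0$, $y^{-1}=y^0:=x^0$, $d^{-1}:=0$. With $\xi^k\in Tx^k$ put $w^k:=Fx^k+\xi^k$, $\hat w^k:=Fy^{k-1}+\xi^k$, $z^k:=u^k+\xi^k$. For $k\ge0$: $$x^{k+1}:=y^k-\eta d^k,\qquad y^{k+1}:=x^{k+1}+\theta_k(x^{k+1}-x^k)-p^k,$$ $$d^k:=\hat w^{k+1}-\gamma_kz^k,\qquad p^k:=\eta_kz^{k+1}-\lambda_k\hat w^{k+1}+\nu_kz^k,$$ where the implicit definition of $x^{k+1}$ means $x^{k+1}=J_{\eta T}(y^k-\eta Fy^k+\eta\gamma_kz^k)$ and $\xi^{k+1}:=\frac1\eta(y^k-\eta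 Fy^k+\eta\gamma_kz^k-x^{k+1})\in Tx^{k+1}$. Parameters: $t_{k+1}=t_k+1$ and $$\theta_k:=\frac{t_k-r-\mu}{t_{k+1}},\quad\gamma_k:=\frac{t_k-r+1}{t_k},\quad\eta_k:=\frac{(\eta-\beta)t_k-\delta}{t_{k+1}},\quad\lambda_k:=\frac{\eta t_k}{t_{k+1}},\quad\nu_k:=\frac{\beta t_k}{t_{k+1}},$$ $$\delta:=(r-1)\beta+\frac{(r-2)(\eta-\beta)}{\mu+1},\qquad\omega:=\frac{\mu(\eta-\beta)}{\mu+1}.$$ Constants: $$t_0:=\max\Big\{\bar t_0,\ \hat t_0,\ r,\ \frac{\eta(r-1)}{\eta-\beta},\ \frac\mu\omega(r-1)[\eta-(2r+1)\omega],\ \frac{(r-2)\sqrt{\omega r}}{\sqrt{\eta(\mu-1)}}\Big\},$$ where $\bar t_0:=\frac{D+\sqrt{D^2+4\eta E}}{2\eta}$ with $D:=2\delta+\omega(r+\mu-1)^2+6r\eta+2\beta+2\hat\epsilon\eta$ and $E:=4\rho r(r-2)+3r\eta+8\rho+\hat\epsilon\eta$; and $\hat t_0:=\frac{B+\sqrt{B^2-AC}}{A}$ if $B^2\ge AC$, $\hat t_0:=0$ otherwise, with $$A:=\frac{(\eta-\beta)^2}{(\mu+1)^2}\Big(\mu-\frac1{2r}-\frac12\Big),\qquad B:=\frac{\eta-\beta}{(\mu+1)^2}\Big[\frac{(r-1)[2r\mu(\eta-\beta)-(\eta+\mu\beta)]}{2r}+\rho(\mu+1)(2r\mu-1)\Big],$$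 $$C:=(r-1)\Big\{\frac{(r-1)(\eta+\mu\beta)}{(\mu+1)^2}\Big[\Big(\mu-\frac1{2r}\Big)\eta-\frac{(2r+1)\mu\beta}{2r}\Big]-2\rho[\eta-(2r+1)\omega]\Big\}.$$ *)

(* Defs.v *)
From HB Require Import structures.
From mathcomp Require Import all_boot all_order all_algebra.
From mathcomp Require Import all_classical all_reals all_analysis.
From mathcomp Require Import ring.

Set Implicit Arguments.
Unset Strict Implicit.
Unset Printing Implicit Defensive.

Import Order.TTheory GRing.Theory Num.Theory.
Import numFieldNormedType.Exports.

Local Open Scope classical_set_scope.
Local Open Scope ring_scope.

(* The library norm `|x| on 'rV[R]_p is the sup norm, hence [enorm] below; the
   library topology on 'rV[R]_p is the usual one, so [closed] and the
   convergence arrows are used as they are. *)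

Section Operators.
Context {R : realType} {p : nat}.
Local Notation V := 'rV[R]_p.

Definition dot (u v : V) : R := \sum_(i < p) u 0 i * v 0 i.

Definition enorm (u : V) : R := Num.sqrt (dot u u).

Definition Lipschitz (L : R) (F : V -> V) : Prop :=
  forall x y, enorm (F x - F y) <= L * enorm (x - y).

Definition opsum (F : V -> V) (T : V -> set V) : V -> set V :=
  fun x => [set F x + v | v in T x].

Definition dom (Phi : V -> set V) : set V := [set x | Phi x !=set0].

Definition gra (Phi : V -> set V) : set (V * V) := [set xu | Phi xu.1 xu.2].

Definition zer (Phi : V -> set V) : set V := [set x | Phi x 0].

Definition co_hypomonotone (rho : R) (Phi : V -> set V) : Prop :=
  forall x u y v, gra Phi (x, u) -> gra Phi (y, v) ->
    - rho * enorm (u - v) ^+ 2 <= dot (u - v) (x - y).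

Definition resolvent (eta : R) (T : V -> set V) (x : V) : set V :=
  [set y | exists2 v, T y v & x = y + eta *: v].

(* Full domain and single-valued. *)
Definition is_map (J : V -> set V) : Prop := forall x, exists y, J x = [set y].

End Operators.

Section Constants.
Context {R : realType}.
Variables (rho r mu epsh eta beta : R).

Definition delta : R :=
  (r - 1) * beta + (r - 2) * (eta - beta) / (mu + 1).

Definition omega : R := mu * (eta - beta) / (mu + 1).

(* In the next five definitions [t] stands for t_k, and [t + 1] for t_(k+1). *)
Definition theta_at (t : R) : R := (t - r - mu) / (t + 1).
Definition gamma_at (t : R) : R := (t - r + 1) / t.
Definition eta_at (t : R) : R := ((eta - beta) * t - delta) / (t + 1).
Definition lambda_at (t : R) : R := eta * t / (t + 1).
Definition nu_at (t : R) : R := beta * t / (t + 1).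

Definition tD : R :=
  2 * delta + omega * (r + mu - 1) ^+ 2 + 6 * r * eta + 2 * beta
  + 2 * epsh * eta.

Definition tE : R :=
  4 * rho * r * (r - 2) + 3 * r * eta + 8 * rho + epsh * eta.

Definition tbar0 : R := (tD + Num.sqrt (tD ^+ 2 + 4 * eta * tE)) / (2 * eta).

Definition tA : R :=
  (eta - beta) ^+ 2 / (mu + 1) ^+ 2 * (mu - 1 / (2 * r) - 1 / 2).

Definition tB : R :=
  (eta - beta) / (mu + 1) ^+ 2 *
  ((r - 1) * (2 * r * mu * (eta - beta) - (eta + mu * beta)) / (2 * r)
   + rho * (mu + 1) * (2 * r * mu - 1)).

Definition tC : R :=
  (r - 1) *
  ((r - 1) * (eta + mu * beta) / (mu + 1) ^+ 2 *
     ((mu - 1 / (2 * r)) * eta - (2 * r + 1) * mu * beta / (2 * r))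
   - 2 * rho * (eta - (2 * r + 1) * omega)).

Definition that0 : R :=
  if tA * tC <= tB ^+ 2 then (tB + Num.sqrt (tB ^+ 2 - tA * tC)) / tA else 0.

Definition t0 : R :=
  Num.max tbar0 (Num.max that0 (Num.max r (Num.max
    (eta * (r - 1) / (eta - beta)) (Num.max
    (mu / omega * (r - 1) * (eta - (2 * r + 1) * omega))
    ((r - 2) * Num.sqrt (omega * r) / Num.sqrt (eta * (mu - 1))))))).

End Constants.

Definition Psi {R : realType} (r epsh kappa kappah : R) : R :=
  1 / Num.sqrt (4 + 12 * kappa + 3 * kappa * r + kappa * epsh)
  * (1 - 1 / (3 * r) - kappah * (12 + 3 * r + epsh)).

Section Scheme.
Context {R : realType} {p : nat}.
Local Notation V := 'rV[R]_p.
Variables (r mu eta beta : R) (t : nat -> R) (F : V -> V) (T : V -> set V).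
Variables (x y u xi : nat -> V).

(* At k = 0 this uses k.-1 = 0, i.e. the convention y^(-1) = y^0. *)
Definition what (k : nat) : V := F (y k.-1) + xi k.

Definition zdir (k : nat) : V := u k + xi k.

Definition ddir (k : nat) : V := what k.+1 - gamma_at r (t k) *: zdir k.

Definition pdir (k : nat) : V :=
  eta_at r mu eta beta (t k) *: zdir k.+1 - lambda_at eta (t k) *: what k.+1
  + nu_at beta (t k) *: zdir k.

Definition rarg (k : nat) : V :=
  y k - eta *: F (y k) + (eta * gamma_at r (t k)) *: zdir k.

(* x^(k+1) = y^k - eta d^k is implicit in x^(k+1), since d^k depends on
   xi^(k+1); it is recorded in its resolvent form, see [GAEGp_xS]. *)
Record GAEGp : Prop := {
  GAEGp_dom : dom (opsum F T) (x 0);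
  GAEGp_xi0 : T (x 0) (xi 0);
  GAEGp_u0 : u 0 = F (x 0);
  GAEGp_y0 : y 0 = x 0;
  GAEGp_res : forall k, resolvent eta T (rarg k) = [set x k.+1];
  GAEGp_xi : forall k, xi k.+1 = eta^-1 *: (rarg k - x k.+1);
  GAEGp_y : forall k,
    y k.+1 = x k.+1 + theta_at r mu (t k) *: (x k.+1 - x k) - pdir k }.

Lemma GAEGp_xS (k : nat) : eta != 0 -> GAEGp -> x k.+1 = y k - eta *: ddir k.
Proof.
move=> eta0 G; rewrite /ddir /what /= (GAEGp_xi G) scalerBr scalerDr !scalerA.
rewrite mulfV// scale1r /rarg !opprB !opprD.
apply/esym/rowP => i; rewrite !mxE; ring.
Qed.

Lemma GAEGp_xiS (k : nat) : eta != 0 -> GAEGp -> T (x k.+1) (xi k.+1).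
Proof.
move=> eta0 G; rewrite (GAEGp_xi G).
have : resolvent eta T (rarg k) (x k.+1) by rewrite (GAEGp_res G).
by case=> v Tv ->; rewrite addrC addKr scalerA mulVf// scale1r.
Qed.

End Scheme.

(* Main.v *)
Require Import Defs.
From HB Require Import structures.
From mathcomp Require Import all_boot all_order all_algebra.
From mathcomp Require Import all_classical all_reals all_analysis.
From mathcomp Require Import ring lra.

Set Implicit Arguments.
Unset Strict Implicit.
Unset Printing Implicit Defensive.

Import Order.TTheory GRing.Theory Num.Theory.
Import numFieldNormedType.Exports.

Local Open Scope classical_set_scope.
Local Open Scope ring_scope.

(** Convergence follows from a single Lyapunov function, used twice.

    Fix a zero of F + T and let x be the iterate measured from it.  Put
    q = t (y - x), w = F x + xi, z = u + xi, s = eta - beta,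
    sigma = s / (mu + 1) and omega = mu sigma.  Eliminating y and the
    extrapolated values from the scheme leaves
      q' = q - (r + mu) (x' - x) - (s t - delta) z' + (s t - eta (r - 1)) z,
    where primes denote the next iterate.  The energy is
      E = |r x + q + (s t - s - delta) z|^2 / 2 + r mu |x|^2 / 2
          - omega t <w, q> - omega s t^2 |z|^2 / 2 + omega eta K t^2 |d|^2.
    In E' - E the products <x, x' - x> and t <z, x' - x> cancel, and up to
    terms of lower order in t ([energy_step], [negligible_remainder]) there
    remain negative multiples of t |x' - x|^2, of t |z|^2 and of <x, w>, a
    product of x with the error w - z, and t^2 times a quadratic form in the
    direction d and the errors.  With the last term of E, which telescopes, this
    form becomes negative definite ([direction_block]) because F + T is
    co-hypomonotone, because beta >= 8 rho and because the step size makes the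
    errors small: if a2 and c2 bound the squared errors of the extrapolated
    value and of z relatively to |d|^2, then 4 a2 + 18 c2 <= 1
    ([step_size_bound]).  The energy being also coercive in x
    for large t ([energy_coercive]), one gets
      E' <= (1 + C / t^2) E - c D,  where
      D = t^2 (|d'|^2 + |d|^2) + t (|x' - x|^2 + |z|^2)
    ([lyapunov_descent]), and a decreasing weight absorbs the factor
    ([discounted_descent]).  Hence E at one late time bounds |x|^2 at all later
    times and the sum of D ([stability]).

    As D is summable and 1 / t is not, |q|^2 + t^2 |z|^2 + t^2 |d|^2 tends to 0
    along a subsequence ([summable_liminf]).  Along it w tends to 0, so a
    cluster point of the iterates is a zero because the graph of T is closed.
    Now measure x from that very cluster point: E becomes arbitrarily small, so
    the whole sequence converges to it ([convergence]).  Finally y - x tends to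
    0 since the dissipation does. *)

(** * Inner product *)

Section InnerProduct.
Context {R : realType} {p : nat}.
Implicit Types (u v w : 'rV[R]_p) (a : R).

Lemma dotC u v : dot u v = dot v u.
Proof. by apply: eq_bigr => i _; rewrite mulrC. Qed.

Lemma dotDl u v w : dot (u + v) w = dot u w + dot v w.
Proof. by rewrite /dot -big_split/=; apply: eq_bigr => i _; rewrite mxE mulrDl. Qed.

Lemma dotZl a u v : dot (a *: u) v = a * dot u v.
Proof. by rewrite /dot mulr_sumr; apply: eq_bigr => i _; rewrite mxE mulrA. Qed.

Lemma dotNl u v : dot (- u) v = - dot u v.
Proof. by rewrite -scaleN1r dotZl mulN1r. Qed.

Lemma dotDr u v w : dot w (u + v) = dot w u + dot w v.
Proof. by rewrite dotC dotDl !(dotC w). Qed.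

Lemma dotZr a u v : dot u (a *: v) = a * dot u v.
Proof. by rewrite dotC dotZl dotC. Qed.

Lemma dotNr u v : dot u (- v) = - dot u v.
Proof. by rewrite dotC dotNl dotC. Qed.

Definition dotE := (dotDl, dotDr, dotNl, dotNr, dotZl, dotZr).

Lemma dot_ge0 u : 0 <= dot u u.
Proof. by apply: sumr_ge0 => i _; exact: sqr_ge0. Qed.

Lemma sqr_enorm u : enorm u ^+ 2 = dot u u.
Proof. by rewrite /enorm sqr_sqrtr// dot_ge0. Qed.

Lemma young a u v : 0 < a -> 2 * dot u v <= a * dot u u + a^-1 * dot v v.
Proof.
move=> a0; have := dot_ge0 (a *: u - v); rewrite !dotE (dotC v u) => P.
have -> : a * dot u u + a^-1 * dot v v = a^-1 * (a * (a * dot u u) + dot v v).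
  by field; rewrite gt_eqF.
rewrite mulrC ler_pdivlMl//; lra.
Qed.

Lemma dot_sqrD u v : dot (u + v) (u + v) <= 2 * dot u u + 2 * dot v v.
Proof. have := dot_ge0 (u - v); rewrite !dotE (dotC v u); lra. Qed.

End InnerProduct.

(** * Variation of the energy over one step *)

Section OneStep.
Context {R : realType} {p : nat}.
Variables (r mu sigma beta K : R).

Let s := (mu + 1) * sigma.
Let et := s + beta.
Let om := mu * sigma.
Let de := (r - 1) * beta + (r - 2) * sigma.
Let b := s + de.

(** With x measured from a zero x* of F + T, q = t (y - x) and d the direction
    of the previous iteration, this is the Lyapunov function of the scheme.  It
    mixes w = F x + xi and z = u + xi on purpose: z obeys the exact recursion,
    so it enters the square, while w is the element of F + T to which
    monotonicity applies, so it is paired with q. *)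
Definition energy (t : R) (x q z w d : 'rV[R]_p) : R :=
  let h := r *: x + q + (s * t - b) *: z in
  dot h h / 2 + r * mu / 2 * dot x x - om * t * dot w q
  - om * s / 2 * t ^+ 2 * dot z z + om * et * K * t ^+ 2 * dot d d.

(** Every term is of lower order than t^2 |d|^2 + t |D|^2 + t |z|^2: either t
    times a product with one factor of the size of d, or a product without the
    factor t.  All coefficients are kept inside the inner products, so that the
    size of each term can be read off its two factors. *)
Definition remainder (t : R) (D z d f e e' : 'rV[R]_p) : R :=
  let j := r - 1 in
  let R2 := (r - 2) * om in
  let g := (j / t) *: z in
  let v := d + f in
  let v' := v - e' in
  let w' := z + (v - g) in
  let c1 := - (r + mu) *: D + (r - 2) * sigma *: z + de *: (v' - g) in
  let c2 := - (r - 2) *: z + (v' - g) in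
  let l := R2 *: z + mu *: D in
  t * dot d (- et *: l + (om * et * j) *: z - (om * et) *: w' + (2 * om * et * K) *: d)
  + t * dot (v - g) (- om *: (c1 + D))
  + t * dot v' ((om * s) *: (w' - c2 - j *: z))
  + t * dot (v' - g) (- (om * b) *: z)
  + (dot z (b *: l) + dot l (2^-1 *: l) + dot D ((r * mu / 2) *: D)
     + dot w' (- om *: c1) + dot c2 (- (om * s / 2) *: c2)
     + dot d ((om * et * K) *: d)).

(** Exact variation of the energy.  D is the increment of x, f and e' are the
    errors of w at the new point with respect to the extrapolated value
    d + zh and to z', e is the error w - z at the old point.  The
    weights r and r * mu of x and the weight om = mu * sigma of <w, q> are
    exactly those that cancel the products <x, D> and t <z, D>. *)
Lemma energy_step t (x D z d f e e' dp : 'rV[R]_p) : t != 0 ->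
  let q := t *: (D + et *: d) in
  let zh := (1 - (r - 1) / t) *: z in
  let w := z + e in
  let w' := d + zh + f in
  let z' := w' - e' in
  let q' := q - (r + mu) *: D - (s * t - de) *: z' + (s * t - et * (r - 1)) *: z in
  energy (t + 1) (x + D) q' z' w' d - energy t x q z w dp =
  - r * ((r - 2) * om) * (dot x w - dot x e)
  - mu * t * dot D D - (r - 2) * om * sigma * t * dot z z
  - om * t ^+ 2 * (dot (w' - w) D + et * dot (d + f - e) d
      - s / 2 * dot (d + f) (d + f) + s / 2 * dot e' e')
  + om * et * K * t ^+ 2 * (dot d d - dot dp dp)
  + remainder t D z d f e e'.
Proof.
move=> t0 /=; rewrite /energy /remainder /b /de /et /s /om.
rewrite !dotE.
rewrite ?(dotC D x) ?(dotC z x) ?(dotC d x) ?(dotC f x) ?(dotC e x) ?(dotC e' x).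
rewrite ?(dotC z D) ?(dotC d D) ?(dotC f D) ?(dotC e D) ?(dotC e' D).
rewrite ?(dotC d z) ?(dotC f z) ?(dotC e z) ?(dotC e' z).
rewrite ?(dotC f d) ?(dotC e d) ?(dotC e' d).
rewrite ?(dotC e f) ?(dotC e' f) ?(dotC e' e).
by field.
Qed.

End OneStep.

(** * Quadratic estimates for one step *)

Section Bounds.
Context {R : realType} {p : nat}.

(** The part of order t^2 of the energy decrease, after the increment of x has
    been removed by co-hypomonotonicity.  The identity
    2 <d + f, d> = |d|^2 + |d + f|^2 - |f|^2 turns it into
    et / 2 * (|d|^2 - |f|^2) + beta / 2 * |d + f|^2 - et <e, d> up to the rho
    term and a nonnegative multiple of |e'|^2, and beta >= 8 rho pays for the
    rho term.  The negative multiple of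
    |dp|^2, which comes from e, is telescoped by the last term of the energy. *)
Lemma direction_block (et beta rho a2 c2 : R) (d f e e' dp : 'rV[R]_p) :
  0 <= rho -> 8 * rho <= beta -> beta <= et -> 4 * a2 + 18 * c2 <= 1 ->
  dot f f <= a2 * dot d d -> dot e e <= c2 * dot dp dp ->
  et * ((3 / 8 - a2 / 2) * dot d d - (1 / 8 - a2 / 2) * dot dp dp) <=
  et * dot (d + f - e) d - rho * dot (d + f - e) (d + f - e)
  - (et - beta) / 2 * dot (d + f) (d + f) + (et - beta) / 2 * dot e' e'.
Proof.
move=> rho0 br be ac fd ed.
have et0 : 0 <= et by lra.
have De := dot_ge0 e; have De' := dot_ge0 e'; have Dv := dot_ge0 (d + f).
have Dp := dot_ge0 dp.
have V := dot_sqrD (d + f) (- e); rewrite !(dotNl e, dotNr (- e)) dotNr opprK in V.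
have Y : 2 * dot e d <= 4 * dot e e + 4^-1 * dot d d by apply: young.
(* the rho-term is absorbed by beta / 2 and by et / 4 *)
have P1 : rho * dot (d + f - e) (d + f - e) <=
    beta / 2 * dot (d + f) (d + f) + et / 4 * dot e e.
  apply: (@le_trans _ _ (rho * (2 * dot (d + f) (d + f) + 2 * dot e e))).
    by rewrite ler_wpM2l.
  have : 0 <= (beta / 2 - 2 * rho) * dot (d + f) (d + f) by rewrite mulr_ge0//; lra.
  have : 0 <= (et / 4 - 2 * rho) * dot e e by rewrite mulr_ge0//; lra.
  lra.
have P2 : et * dot f f <= et * (a2 * dot d d) by rewrite ler_wpM2l.
have P3 : 9 / 4 * et * dot e e <= et * ((1 - 4 * a2) / 8 * dot dp dp).
  rewrite -mulrA mulrCA ler_wpM2l//.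
  have : 0 <= ((1 - 4 * a2) / 18 - c2) * dot dp dp by rewrite mulr_ge0//; lra.
  lra.
have P4 : et * (2 * dot e d) <= et * (4 * dot e e + 4^-1 * dot d d) by rewrite ler_wpM2l.
have P5 : 0 <= (et - beta) / 2 * dot e' e' by rewrite mulr_ge0//; lra.
have -> : dot (d + f - e) d =
  (dot d d + dot (d + f) (d + f) - dot f f) / 2 - dot e d.
  by rewrite !dotE (dotC f d); lra.
lra.
Qed.

Section Coercivity.
Variables (r mu sigma beta K : R).
Let s := (mu + 1) * sigma.
Let et := s + beta.
Let om := mu * sigma.
Let de := (r - 1) * beta + (r - 2) * sigma.
Let b := s + de.

Lemma params_gt0 : 2 < r -> 1 < mu -> 0 < sigma -> 0 <= beta ->
  [/\ 0 < om, 0 < s, 0 < et, om <= et & 0 < b].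
Proof.
move=> r2 mu1 sigma0 beta0.
have om0 : 0 < om by rewrite mulr_gt0//; lra.
have s0 : 0 < s by rewrite mulr_gt0//; lra.
have de0 : 0 < de.
  apply: ltr_wpDl; last by rewrite mulr_gt0//; lra.
  by rewrite mulr_ge0//; lra.
by split=> //; rewrite /b /et; [lra | rewrite /s /om; lra | lra].
Qed.

(** Expand in X = r x + q: since r t <w, x> is nonnegative up to the rho term,
    it can be dropped, and the rest is a quadratic form in X, t z and t e that
    is a sum of squares for large t.  The last term of the energy dominates the
    product of X with e. *)
Lemma energy_coercive (rho c2 t : R) (x q z e d : 'rV[R]_p) :
  2 < r -> 1 < mu -> 0 < sigma -> 0 <= beta ->
  0 <= rho -> 9 / 2 * c2 <= K ->
  dot e e <= c2 * dot d d ->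
  - rho * dot (z + e) (z + e) <= dot x (z + e) ->
  b <= sigma * t -> b * s + 2 * om * r * rho <= sigma ^+ 2 / 4 * t ->
  2 * r * rho <= 3 * et * t ->
  r * mu / 2 * dot x x <= energy r mu sigma beta K t x q z (z + e) d.
Proof.
move=> r2 mu1 sigma0 beta0 rho0 cK ed xw t1 t2 t3.
have [om0 s0 et0 omet b0] := params_gt0 r2 mu1 sigma0 beta0.
rewrite /energy -/s -/et -/om -/de -/b.
have t0 : 0 < t by rewrite -(pmulr_rgt0 _ sigma0); lra.
set X := r *: x + q; set g := s * t - b - om * t.
have gE : g = sigma * t - b by rewrite /g /s /om; ring.
have dq : dot (z + e) q = dot (z + e) X - r * dot (z + e) x.
  by rewrite /X !dotE; ring.
rewrite dq.
have Dz := dot_ge0 z; have De := dot_ge0 e; have Dd := dot_ge0 d.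
(* one third of |X|^2 goes to z and one sixth to e *)
have S1 := dot_ge0 (2 *: X + (3 * g) *: z).
have S2 := dot_ge0 (X - (3 * om * t) *: e).
have V := dot_sqrD z e.
have P1 : om * r * t * (- rho * (2 * dot z z + 2 * dot e e)) <=
          om * r * t * dot x (z + e).
  rewrite ler_wpM2l//; first by apply: mulr_ge0; [apply: mulr_ge0|]; lra.
  by apply: le_trans xw; rewrite !mulNr lerN2 ler_wpM2l.
have P2 : 9 / 2 * om * et * t ^+ 2 * dot e e <= om * et * K * t ^+ 2 * dot d d.
  rewrite (_ : 9 / 2 * om * et * t ^+ 2 * dot e e =
    om * et * t ^+ 2 * (9 / 2 * dot e e)); last by ring.
  rewrite (_ : om * et * K * t ^+ 2 * dot d d =
    om * et * t ^+ 2 * (K * dot d d)); last by ring.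
  rewrite ler_wpM2l//; first exact/ltW/(mulr_gt0 (mulr_gt0 om0 et0))/exprn_gt0.
  apply: (@le_trans _ _ (9 / 2 * (c2 * dot d d))); first by rewrite ler_wpM2l.
  by rewrite mulrA ler_wpM2r.
have P3 : 3 / 2 * om ^+ 2 * t ^+ 2 * dot e e <= 3 / 2 * om * et * t ^+ 2 * dot e e.
  by rewrite !ler_wpM2r ?sqr_ge0// expr2 mulrA ler_wpM2l//; lra.
have P4 : om * t * (2 * r * rho) * dot e e <= om * t * (3 * et * t) * dot e e.
  by rewrite ler_wpM2r// ler_wpM2l// ltW// mulr_gt0.
have P5 : 3 / 4 * g ^+ 2 * dot z z <= 3 / 4 * (sigma * t) ^+ 2 * dot z z.
  have g0 : 0 <= g by rewrite gE; lra.
  have g1 : g <= sigma * t by rewrite gE; lra.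
  by rewrite ler_wpM2r// ler_wpM2l// lerXn2r ?nnegrE// (le_trans g0).
have P6 : (2 * om * r * rho * t + 3 / 4 * (sigma * t) ^+ 2) * dot z z <=
   ((s * t - b) ^+ 2 - om * s * t ^+ 2) / 2 * dot z z.
  rewrite ler_wpM2r//.
  have Q1 : (b * s + 2 * om * r * rho) * t <= sigma ^+ 2 / 4 * t * t.
    by rewrite ler_wpM2r// ltW.
  have Q2 : 0 <= (mu - 1) * (sigma * t) ^+ 2 by rewrite mulr_ge0 ?sqr_ge0//; lra.
  have Q3 := sqr_ge0 b.
  by move: Q1 Q2 Q3; rewrite /s /om; lra.
have gD : s * t - b = g + om * t by rewrite /g; ring.
clear gE dq; clearbody X g.
move: S1 S2 P1 P2 P3 P4 P5 P6.
rewrite !dotE (dotC z X) (dotC e X) (dotC z x) (dotC e x) gD.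
lra.
Qed.


Lemma energy_bounded (c2 t : R) (x q z e d : 'rV[R]_p) :
  2 < r -> 1 < mu -> 0 < sigma -> 0 <= beta -> 0 <= K -> 1 <= t ->
  dot e e <= c2 * dot d d ->
  energy r mu sigma beta K t x q z (z + e) d <=
  (2 * r ^+ 2 + r * mu) * dot x x + (2 + om) * dot q q
  + ((s + b) ^+ 2 + om) * (t ^+ 2 * dot z z)
  + (om * `|c2| + om * et * K) * (t ^+ 2 * dot d d).
Proof.
move=> r2 mu1 sigma0 beta0 K0 t1 ed.
have [om0 s0 et0 _ b0] := params_gt0 r2 mu1 sigma0 beta0.
rewrite /energy -/s -/et -/om -/de -/b.
set g := s * t - b.
have Dz := dot_ge0 z; have De := dot_ge0 e; have Dd := dot_ge0 d.
have Dx := dot_ge0 x; have Dq := dot_ge0 q.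
have V1 := dot_sqrD (r *: x + q) (g *: z).
have V2 := dot_sqrD (r *: x) q.
have g1 : - (s + b) * t <= g.
  have : b * 1 <= b * t by rewrite ler_wpM2l// ltW.
  have : 0 <= s * t by rewrite mulr_ge0// ltW//; lra.
  by rewrite /g; lra.
have g2 : g <= (s + b) * t.
  have : 0 <= b * t by rewrite mulr_ge0// ltW//; lra.
  by rewrite /g; lra.
have g3 : g ^+ 2 * dot z z <= ((s + b) * t) ^+ 2 * dot z z.
  rewrite ler_wpM2r// -[leLHS]real_normK ?num_real// lerXn2r ?nnegrE//.
    by apply: mulr_ge0; lra.
  by rewrite ler_norml g2 andbT -mulNr.
have Y : 2 * dot (- t *: (z + e)) q <=
    1 * dot (- t *: (z + e)) (- t *: (z + e)) + 1^-1 * dot q q.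
  exact: young.
have V3 := dot_sqrD z e.
have E3 : om * (t ^+ 2 * dot (z + e) (z + e)) <=
   om * (t ^+ 2 * (2 * dot z z + 2 * dot e e)).
  by rewrite ler_wpM2l ?ler_wpM2l ?sqr_ge0// ltW.
have E4 : om * (t ^+ 2 * dot e e) <= om * (t ^+ 2 * (`|c2| * dot d d)).
  rewrite ler_wpM2l ?ler_wpM2l ?sqr_ge0 ?(ltW om0)//.
  by apply: le_trans ed _; rewrite ler_wpM2r// ler_norm.
have E5 : 0 <= om * (t ^+ 2 * dot z z).
  by apply: mulr_ge0; [lra | rewrite mulr_ge0 ?sqr_ge0].
have E6 : 0 <= om * s * (t ^+ 2 * dot z z).
  by apply: mulr_ge0; [apply: mulr_ge0; exact: ltW | rewrite mulr_ge0 ?sqr_ge0].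
have E7 : om * (2 * dot (- t *: (z + e)) q) <=
    om * (1 * dot (- t *: (z + e)) (- t *: (z + e)) + 1^-1 * dot q q).
  by rewrite ler_wpM2l// ltW.
have E8 : 0 <= om * dot q q by rewrite mulr_ge0// ltW.
have E9 : 0 <= r * mu * dot x x by rewrite !mulr_ge0//; lra.
move: V1 E3 E7; clear V3 Y; clearbody g; rewrite !(dotZl, dotZr) invr1.
move: (dot (r *: x + q) (r *: x + q)) V2.
rewrite !(dotZl, dotZr) => N V2 V1 E3 E7.
lra.
Qed.

End Coercivity.
End Bounds.

(** * Terms of lower order *)

Section Negligible.
Context {R : realType} {p : nat}.
Variables (t D : nat -> R).
Hypotheses (t1 : forall k, 1 <= t k) (tS : forall k, t k.+1 = t k + 1).
Hypothesis D0 : forall k, 0 <= D k.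
Implicit Types (A B : nat -> 'rV[R]_p) (a b : nat -> R).

(** For D the dissipation, n = 2 is the size of the directions and of the
    errors, n = 1 the size of z and of the increments of x. *)
Definition weighted n A :=
  exists2 C, 0 <= C & forall k, t k ^+ n * dot (A k) (A k) <= C * D k.

(** One-sided little-o of D, which is what an upper bound on the energy needs. *)
Definition negligible a :=
  forall theta, 0 < theta -> \forall k \near \oo, a k <= theta * D k.

Lemma t_unbounded M : \forall k \near \oo, M <= t k.
Proof.
have tk k : k%:R <= t k.
  elim: k => [|k IH]; first by rewrite (le_trans _ (t1 0)).
  by rewrite tS -natr1 lerD2r.
near=> k; apply: le_trans (tk k).
by near: k; exact: nbhs_infty_ger.
Unshelve. all: by end_near. Qed.

Lemma weightedD n A B :
  weighted n A -> weighted n B -> weighted n (fun k => A k + B k).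
Proof.
move=> [C C0 CA] [C' C'0 CB]; exists (2 * C + 2 * C'); first lra.
move=> k; have tn : 0 <= t k ^+ n by rewrite exprn_ge0// (le_trans _ (t1 k)).
have := ler_wpM2l tn (dot_sqrD (A k) (B k)); have := CA k; have := CB k; lra.
Qed.

Lemma weightedZ n c A : weighted n A -> weighted n (fun k => c *: A k).
Proof.
move=> [C C0 CA]; exists (c ^+ 2 * C); first by rewrite mulr_ge0 ?sqr_ge0.
move=> k; have := ler_wpM2l (sqr_ge0 c) (CA k); rewrite !dotE; lra.
Qed.

Lemma weightedN n A : weighted n A -> weighted n (fun k => - A k).
Proof. by move=> [C C0 CA]; exists C => // k; rewrite !dotE opprK. Qed.

Lemma weightedW A : weighted 2 A -> weighted 1 A.
Proof.
move=> [C C0 CA]; exists C => // k; apply: le_trans (CA k).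
by rewrite ler_wpM2r ?dot_ge0// ler_weXn2l// t1.
Qed.

Lemma weighted_div c A : weighted 1 A -> weighted 2 (fun k => (c / t k) *: A k).
Proof.
move=> [C C0 CA]; exists (c ^+ 2 * C); first by rewrite mulr_ge0 ?sqr_ge0.
move=> k; have t0 : 0 < t k by rewrite (lt_le_trans _ (t1 k)).
rewrite !dotE.
have -> : t k ^+ 2 * (c / t k * (c / t k * dot (A k) (A k))) =
  c ^+ 2 * dot (A k) (A k) by field; rewrite gt_eqF.
rewrite -[leRHS]mulrA ler_wpM2l ?sqr_ge0//; apply: le_trans (CA k).
by rewrite expr1 ler_peMl ?dot_ge0.
Qed.

Lemma negligibleD a b :
  negligible a -> negligible b -> negligible (fun k => a k + b k).
Proof.
move=> na nb th th0; have th2 : 0 < th / 2 by lra.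
near=> k.
have : a k <= th / 2 * D k by near: k; exact: na.
have : b k <= th / 2 * D k by near: k; exact: nb.
lra.
Unshelve. all: by end_near. Qed.

(** t <A, B> is the product of t A and B, whose squared norms are O(D) and
    O(D / t). *)
Lemma negligible_tdot A B : weighted 2 A -> weighted 1 B ->
  negligible (fun k => t k * dot (A k) (B k)).
Proof.
move=> [C C0 CA] [C' C'0 CB] th th0.
pose a := th / (C + 1).
have a0 : 0 < a by rewrite divr_gt0//; lra.
near=> k.
have tk : C' / (a * th) <= t k by near: k; exact: t_unbounded.
have t0 : 0 < t k by rewrite (lt_le_trans _ (t1 k)).
have := young (t k *: A k) (B k) a0; rewrite !dotE => Y.
have P1 : a * (t k ^+ 2 * dot (A k) (A k)) <= th * D k.
  apply: (@le_trans _ _ (a * (C * D k))); first by rewrite ler_wpM2l// ltW.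
  rewrite mulrA ler_wpM2r// /a mulrAC ler_pdivrMr; last lra.
  by rewrite ler_wpM2l ?(ltW th0)//; lra.
have P2 : a^-1 * dot (B k) (B k) <= th * D k.
  rewrite ler_pdivrMl// -(ler_pM2l t0).
  apply: le_trans (CB k) _.
  have : C' <= t k * (a * th) by rewrite -ler_pdivrMr// mulr_gt0.
  by move=> /(ler_wpM2r (D0 k)); rewrite !mulrA.
lra.
Unshelve. all: by end_near. Qed.

Lemma negligible_dot A B : weighted 1 A -> weighted 1 B ->
  negligible (fun k => dot (A k) (B k)).
Proof.
move=> wA wB; have := negligible_tdot (weighted_div 1 wA) wB.
congr negligible; apply/funext => k; rewrite dotZl mul1r mulVKf//.
by rewrite gt_eqF// (lt_le_trans _ (t1 k)).
Qed.

Lemma negligible_remainder (r mu sigma beta K : R) dx z d f e e' :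
  weighted 1 dx -> weighted 1 z -> weighted 2 d -> weighted 2 f ->
  weighted 2 e -> weighted 2 e' ->
  negligible (fun k => remainder r mu sigma beta K (t k)
    (dx k) (z k) (d k) (f k) (e k) (e' k)).
Proof.
move=> wx wz wd wf we we'.
have wg := weighted_div (r - 1) wz.
have wv := weightedD wd wf.
have wvg := weightedD wv (weightedN wg).
have wv' := weightedD wv (weightedN we').
have wv'g := weightedD wv' (weightedN wg).
have wl := weightedD (weightedZ ((r - 2) * (mu * sigma)) wz) (weightedZ mu wx).
have ww := weightedD wz (weightedW wvg).
rewrite /remainder /=.
have wc1 : weighted 1 (fun k => - (r + mu) *: dx k + (r - 2) * sigma *: z k
   + ((r - 1) * beta + (r - 2) * sigma) *: (d k + f k - e' k - ((r - 1) / t k) *: z k)).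
  by do ?apply: weightedD; do ?apply: weightedZ => //; exact: weightedW.
have wc2 : weighted 1 (fun k => - (r - 2) *: z k + (d k + f k - e' k - ((r - 1) / t k) *: z k)).
  by apply: weightedD; [exact: weightedZ | exact: weightedW].
do ![apply: negligibleD | apply: negligible_tdot => // | apply: negligible_dot => //
    | apply: weightedD => // | apply: weightedN => // | apply: weightedZ => //
    | exact: weightedW | idtac].
Qed.

End Negligible.

(** * Descent of the energy *)

(** The scheme seen through the sequences that the energy uses: y and the
    extrapolated values have been eliminated.  The index of d is shifted, d k
    being the direction that led to x k, and sigma = (eta - beta) / (mu + 1), so
    that eta reads (mu + 1) * sigma + beta.  The constants a2 and c2 bound the
    squared relative errors of the extrapolated value and of z. *)
Record inertial_system {R : realType} {p : nat}
    (r mu sigma beta rho a2 c2 : R) (t : nat -> R)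
    (x q z w d : nat -> 'rV[R]_p) : Prop := {
  is_t1 : forall k, 1 <= t k;
  is_tS : forall k, t k.+1 = t k + 1;
  is_q : forall k,
    q k = t k *: (x k.+1 - x k + ((mu + 1) * sigma + beta) *: d k.+1);
  is_qS : forall k,
    q k.+1 = q k - (r + mu) *: (x k.+1 - x k)
      - ((mu + 1) * sigma * t k - ((r - 1) * beta + (r - 2) * sigma)) *: z k.+1
      + ((mu + 1) * sigma * t k - ((mu + 1) * sigma + beta) * (r - 1)) *: z k;
  is_extrap : forall k, let h := w k.+1 - d k.+1 - (1 - (r - 1) / t k) *: z k in
    dot h h <= a2 * dot (d k.+1) (d k.+1);
  is_inexact : forall k, let h := w k - z k in dot h h <= c2 * dot (d k) (d k);
  is_mono : forall k,
    - rho * dot (w k.+1 - w k) (w k.+1 - w k) <=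
    dot (w k.+1 - w k) (x k.+1 - x k) }.

Section Descent.
Context {R : realType} {p : nat}.
Variables (r mu sigma beta rho a2 c2 : R) (t : nat -> R).
Variables (x q z w d : nat -> 'rV[R]_p).
Hypotheses (r2 : 2 < r) (mu1 : 1 < mu) (sigma0 : 0 < sigma).
Hypotheses (rho0 : 0 <= rho) (rho_beta : 8 * rho <= beta).
Hypothesis ac : 4 * a2 + 18 * c2 <= 1.
Hypothesis sys : inertial_system r mu sigma beta rho a2 c2 t x q z w d.

Let s := (mu + 1) * sigma.
Let et := s + beta.
Let om := mu * sigma.
(* K balances the two coefficients of [direction_block]: 3/8 - a2/2 exceeds it
   and 1/8 - a2/2 falls short of it by the same margin 1/8. *)
Let K := 1 / 4 - a2 / 2.

Definition lyapunov (xs : 'rV[R]_p) (k : nat) : R :=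
  energy r mu sigma beta K (t k) (x k - xs) (q k) (z k) (w k) (d k).

Definition dissipation (k : nat) : R :=
  t k ^+ 2 * (dot (d k.+1) (d k.+1) + dot (d k) (d k))
  + t k * (dot (x k.+1 - x k) (x k.+1 - x k) + dot (z k) (z k)).

Lemma dissipation_ge0 k : 0 <= dissipation k.
Proof.
have t0 : 0 <= t k by rewrite (le_trans _ (is_t1 sys k)).
by rewrite addr_ge0// mulr_ge0// ?sqr_ge0// addr_ge0// dot_ge0.
Qed.

Let f k := w k.+1 - d k.+1 - (1 - (r - 1) / t k) *: z k.
Let e k := w k - z k.
Let Dx k := x k.+1 - x k.

Lemma lyapunov_step (xs : 'rV[R]_p) (k : nat) :
  - rho * dot (w k) (w k) <= dot (x k - xs) (w k) ->
  lyapunov xs k.+1 <= lyapunov xs k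
  - (mu * t k * dot (Dx k) (Dx k) + (r - 2) * om * sigma * t k * dot (z k) (z k)
     + om * et / 8 * (t k ^+ 2 * (dot (d k.+1) (d k.+1) + dot (d k) (d k))))
  + r * ((r - 2) * om) * dot (x k - xs) (e k)
  + (dot (w k) ((r * ((r - 2) * om) * rho) *: w k)
     + t k * dot (d k.+1 + f k - e k) ((- 2 * om * rho * (r - 1)) *: z k)
     + dot (z k) ((om * rho * (r - 1) ^+ 2) *: z k)
     + remainder r mu sigma beta K (t k) (Dx k) (z k) (d k.+1) (f k) (e k) (e k.+1)).
Proof.
move=> xw.
have [hr hm hs] := And3 r2 mu1 sigma0; have [h0 hb hac] := And3 rho0 rho_beta ac.
have t1 := is_t1 sys k; have t0 : 0 < t k by lra.
have tn0 : t k != 0 by rewrite gt_eqF.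
have [om0 s0 et0 _ _] : [/\ 0 < om, 0 < s, 0 < et, om <= et
   & 0 < s + ((r - 1) * beta + (r - 2) * sigma)].
  by apply: params_gt0 => //; lra.
have /= := energy_step r mu sigma beta K (x k - xs) (Dx k) (z k) (d k.+1) (f k) (e k)
  (e k.+1) (d k) tn0.
rewrite -/s -/om -/et.
have -> : d k.+1 + (1 - (r - 1) / t k) *: z k + f k = w k.+1.
  by rewrite /f /e; apply/rowP => i; rewrite !mxE; ring.
have -> : z k + e k = w k by rewrite /e addrC subrK.
have -> : w k.+1 - e k.+1 = z k.+1 by rewrite /e opprB addrC subrK.
rewrite -(is_q sys k) -(is_qS sys k).
have -> : x k - xs + (Dx k) = x k.+1 - xs by rewrite /Dx addrC subrKA.
rewrite -(is_tS sys k) -!/(lyapunov _ _) => E.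
have [be_et e'2] : beta <= et /\ et - beta = s by rewrite /et; lra.
have blk := direction_block (e k.+1) rho0 rho_beta be_et ac
  (is_extrap sys k) (is_inexact sys k).
rewrite e'2 -/(f k) -/(e k) -/(e k.+1) in blk.
have mono := is_mono sys k; rewrite -/Dx in mono.
have wv : w k.+1 - w k = (d k.+1 + f k - e k) - ((r - 1) / t k) *: z k.
  by rewrite /f /e; apply/rowP => i; rewrite !mxE; ring.
have monoE : dot (w k.+1 - w k) (w k.+1 - w k) =
   dot (d k.+1 + f k - e k) (d k.+1 + f k - e k)
   - 2 * ((r - 1) / t k) * dot (d k.+1 + f k - e k) (z k)
   + ((r - 1) / t k) ^+ 2 * dot (z k) (z k).
  by rewrite wv; move: (d k.+1 + f k - e k) => v; rewrite !dotE (dotC (z k) v); ring.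
have P1 : om * t k ^+ 2 * (- rho * dot (w k.+1 - w k) (w k.+1 - w k)) <=
    om * t k ^+ 2 * dot (w k.+1 - w k) (Dx k).
  by rewrite ler_wpM2l// mulr_ge0 ?sqr_ge0// ltW.
have P2 := blk.
move/(ler_wpM2l (mulr_ge0 (ltW om0) (sqr_ge0 (t k)))) : P2 => P2.
have R0 : 0 <= r * ((r - 2) * om) by apply: mulr_ge0; [|apply: mulr_ge0]; lra.
have P3 := ler_wpM2l R0 xw.
have g1 : t k ^+ 2 * ((r - 1) / t k) = t k * (r - 1) by field.
have g2 : t k ^+ 2 * ((r - 1) / t k) ^+ 2 = (r - 1) ^+ 2 by field.
have P1' : om * t k ^+ 2 * (- rho * dot (w k.+1 - w k) (w k.+1 - w k)) =
  - om * rho * (t k ^+ 2 * dot (d k.+1 + f k - e k) (d k.+1 + f k - e k))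
  + 2 * om * rho * (t k * (r - 1)) * dot (d k.+1 + f k - e k) (z k)
  - om * rho * (r - 1) ^+ 2 * dot (z k) (z k).
  by rewrite monoE -g1 -g2; ring.
rewrite P1' in P1.
rewrite !dotZr.
move: P1 P2 P3 E; clear.
rewrite /K.
move: (remainder _ _ _ _ _ _ _ _ _ _ _ _) => rem.
move: (dot (d k.+1 + f k - e k) (d k.+1 + f k - e k)) (dot (d k.+1 + f k) _)
  (dot (d k.+1 + f k - e k) (d k.+1)) (dot (d k.+1 + f k - e k) (z k))
  (dot (w k.+1 - w k) (Dx k)) (dot (x k - xs) (w k)) (dot (x k - xs) (e k)).
move: (dot (e k.+1) _) (dot (Dx k) (Dx k)) (dot (z k) (z k)) (dot (w k) (w k))
  (dot (d k) (d k)) (dot (d k.+1) _).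
move: (lyapunov xs k) (lyapunov xs k.+1) (t k) => *.
lra.
Qed.

Let weight_bound n (A : nat -> 'rV[R]_p) (C : R) :
  (forall k, t k ^+ n * dot (A k) (A k) <= `|C| * dissipation k) ->
  weighted t dissipation n A.
Proof. by exists `|C|. Qed.

(** Only the product of x - xs with the error w - z is neither dissipated nor
    negligible; Young's inequality splits it into a small multiple of
    t^2 |d|^2 and a multiple of |x - xs|^2 / t^2, which is summable as long as x
    stays bounded. *)
Lemma lyapunov_descent (xs : 'rV[R]_p) :
  (forall k, - rho * dot (w k) (w k) <= dot (x k - xs) (w k)) ->
  exists2 c, 0 < c & exists2 C, 0 <= C & \forall k \near \oo,
    lyapunov xs k.+1 <= lyapunov xs k
      + C / t k ^+ 2 * dot (x k - xs) (x k - xs) - c * dissipation k.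
Proof.
move=> xw.
have [hr hm hs] := And3 r2 mu1 sigma0; have [h0 hb hac] := And3 rho0 rho_beta ac.
have t1 := is_t1 sys; have tS := is_tS sys; have D0 := dissipation_ge0.
have tn0 n k : 0 <= t k ^+ n by rewrite exprn_ge0// (le_trans _ (t1 k)).
have ineqs k : [/\ t k ^+ 2 * dot (d k.+1) (d k.+1) <= dissipation k,
    t k ^+ 2 * dot (d k) (d k) <= dissipation k,
    t k ^+ 1 * dot (Dx k) (Dx k) <= dissipation k &
    t k ^+ 1 * dot (z k) (z k) <= dissipation k].
  have := mulr_ge0 (tn0 2%N k) (dot_ge0 (d k)).
  have := mulr_ge0 (tn0 2%N k) (dot_ge0 (d k.+1)).
  have := mulr_ge0 (tn0 1%N k) (dot_ge0 (Dx k)).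
  have := mulr_ge0 (tn0 1%N k) (dot_ge0 (z k)).
  by rewrite /dissipation -/(Dx k) expr1; split; lra.
have wd : weighted t dissipation 2 (fun k => d k.+1).
  by apply: (@weight_bound _ _ 1) => k; rewrite normr1 mul1r; case: (ineqs k).
have wx : weighted t dissipation 1 Dx.
  by apply: (@weight_bound _ _ 1) => k; rewrite normr1 mul1r; case: (ineqs k).
have wz : weighted t dissipation 1 z.
  by apply: (@weight_bound _ _ 1) => k; rewrite normr1 mul1r; case: (ineqs k).
have bnd C (A B : 'rV[R]_p) k : dot A A <= C * dot B B ->
    t k ^+ 2 * dot B B <= dissipation k -> t k ^+ 2 * dot A A <= `|C| * dissipation k.
  move=> AB BD.
  apply: (@le_trans _ _ (t k ^+ 2 * (`|C| * dot B B))).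
    rewrite ler_wpM2l//; apply: le_trans AB _.
    by rewrite ler_wpM2r ?dot_ge0// ler_norm.
  by rewrite mulrCA ler_wpM2l.
have wf : weighted t dissipation 2 f.
  apply: (@weight_bound _ _ a2) => k.
  by apply: bnd (is_extrap sys k) _; case: (ineqs k).
have we : weighted t dissipation 2 e.
  apply: (@weight_bound _ _ c2) => k.
  by apply: bnd (is_inexact sys k) _; case: (ineqs k).
have we' : weighted t dissipation 2 (fun k => e k.+1).
  apply: (@weight_bound _ _ c2) => k.
  by apply: bnd (is_inexact sys k.+1) _; case: (ineqs k).
have ww : weighted t dissipation 1 w.
  have := weightedD t1 wz (weightedW t1 we); congr weighted.
  by apply/funext => k; rewrite /e addrC subrK.
have nn := negligibleD (negligibleD (negligibleD
    (negligible_dot t1 tS D0 ww (weightedZ (r * ((r - 2) * om) * rho) ww))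
    (negligible_tdot t1 tS D0 (weightedD t1 (weightedD t1 wd wf) (weightedN we))
       (weightedZ (- 2 * om * rho * (r - 1)) wz)))
    (negligible_dot t1 tS D0 wz (weightedZ (om * rho * (r - 1) ^+ 2) wz)))
    (negligible_remainder t1 tS D0 r mu sigma beta K wx wz wd wf we we').
have om0 : 0 < om by rewrite mulr_gt0//; lra.
have et0 : 0 < et by apply: ltr_pwDl; [rewrite mulr_gt0//; lra | lra].
pose c := Num.min mu (Num.min ((r - 2) * om * sigma) (om * et / 8)).
have c0 : 0 < c.
  rewrite /c !lt_min; apply/and3P; split; first lra.
    by rewrite !mulr_gt0//; lra.
  by rewrite divr_gt0// mulr_gt0.
have c1 : c <= mu by rewrite ge_min lexx.
have c2' : c <= (r - 2) * om * sigma by rewrite !ge_min lexx orbT.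
have c3 : c <= om * et / 8 by rewrite !ge_min lexx !orbT.
clearbody c.
pose R0 := r * ((r - 2) * om).
have R00 : 0 < R0 by rewrite !mulr_gt0//; lra.
pose al := c / 2 / (R0 * (`|c2| + 1)).
have cc2 : 0 < `|c2| + 1 by apply: ltr_wpDl.
have al0 : 0 < al by rewrite !divr_gt0// mulr_gt0.
exists (c / 2); first lra.
exists (R0 * al^-1); first by rewrite ltW// mulr_gt0 ?invr_gt0.
have c4 : 0 < c / 4 by lra.
apply: filterS (nn _ c4) => k hn.
have t0 : 0 < t k by rewrite (lt_le_trans _ (t1 k)).
apply: (le_trans (lyapunov_step (xw k))).
have main : c * dissipation k <= mu * t k * dot (Dx k) (Dx k)
     + (r - 2) * om * sigma * t k * dot (z k) (z k)
     + om * et / 8 * (t k ^+ 2 * (dot (d k.+1) (d k.+1) + dot (d k) (d k))).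
  rewrite /dissipation -/(Dx k).
  have B1 : 0 <= t k * dot (Dx k) (Dx k) by rewrite mulr_ge0 ?dot_ge0 ?ltW.
  have B2 : 0 <= t k * dot (z k) (z k) by rewrite mulr_ge0 ?dot_ge0 ?ltW.
  have B3 : 0 <= t k ^+ 2 * (dot (d k.+1) (d k.+1) + dot (d k) (d k)).
    by rewrite mulr_ge0 ?addr_ge0 ?dot_ge0.
  have := ler_wpM2r B1 c1; have := ler_wpM2r B2 c2'; have := ler_wpM2r B3 c3.
  lra.
have cross : R0 * dot (x k - xs) (e k) <=
    R0 / al / t k ^+ 2 * dot (x k - xs) (x k - xs) + c / 4 * dissipation k.
  have Y := young (e k) (x k - xs) (mulr_gt0 al0 (exprn_gt0 2 t0)).
  have Be : t k ^+ 2 * dot (e k) (e k) <= `|c2| * dissipation k.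
    by apply: bnd (is_inexact sys k) _; case: (ineqs k).
  have Be' : R0 * (al * (t k ^+ 2 * dot (e k) (e k))) <= c / 2 * dissipation k.
    apply: (@le_trans _ _ (R0 * (al * ((`|c2| + 1) * dissipation k)))).
      rewrite ler_wpM2l ?(ltW R00)// ler_wpM2l ?(ltW al0)//.
      by apply: le_trans Be _; rewrite mulrDl mul1r lerDl.
    rewrite le_eqVlt; apply/orP; left; apply/eqP; rewrite /al; field.
    by rewrite !gt_eqF.
  have Bx : 0 <= R0 / al / t k ^+ 2 * dot (x k - xs) (x k - xs).
    by rewrite mulr_ge0 ?dot_ge0// divr_ge0// divr_ge0// ltW.
  have Y' := ler_wpM2l (ltW R00) Y.
  have E2 : R0 * ((al * t k ^+ 2)^-1 * dot (x k - xs) (x k - xs)) =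
     R0 / al / t k ^+ 2 * dot (x k - xs) (x k - xs).
    by field; rewrite !gt_eqF.
  rewrite mulrDr E2 (dotC (e k)) in Y'.
  lra.
rewrite -/R0 in hn *.
lra.
Qed.

End Descent.

(** * Absorbing a summable growth factor *)

Section Discount.
Context {R : realType}.
Variables (t E X D : nat -> R) (c C m : R).
Hypotheses (t1 : forall k, 1 <= t k) (tS : forall k, t k.+1 = t k + 1).
Hypotheses (c0 : 0 < c) (C0 : 0 <= C) (m0 : 0 < m).
Hypothesis D0 : forall k, 0 <= D k.

(** A growth factor 1 + b / t^2 is compensated by the decreasing weight
    1 + 2 b / t, because t grows by one unit per step; the weighted energy
    then decreases by at least c D. *)
Lemma discounted_descent :
  (\forall k \near \oo, E k.+1 <= E k + C / t k ^+ 2 * X k - c * D k) ->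
  (\forall k \near \oo, m * X k <= E k) -> (forall k, 0 <= X k) ->
  exists2 M, 0 < M & \forall k1 \near \oo, forall n, (k1 <= n)%N ->
    X n <= M * E k1 /\ \sum_(k1 <= i < n) D i <= M * E k1.
Proof.
move=> dsc coe X0.
have [tt tS' cc CC mm] := And5 t1 tS c0 C0 m0.
pose b := C / m.
have b0 : 0 <= b by rewrite divr_ge0// ltW.
pose W k := (1 + 2 * b / t k) * E k.
have cm0 : 0 < c^-1 by rewrite invr_gt0.
have mm0 : 0 < m^-1 by rewrite invr_gt0.
exists ((1 + 2 * b) * (c^-1 + m^-1)).
  by apply: mulr_gt0; lra.
have [N _ HN] : \forall k \near \oo, [/\ E k.+1 <= E k + C / t k ^+ 2 * X k - c * D k,
   m * X k <= E k & 1 + 2 * b <= t k].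
  near=> k; split; near: k => //.
  exact: (t_unbounded t1 tS).
have Wstep k : (N <= k)%N -> W k.+1 + c * D k <= W k.
  move=> Nk; have := HN k Nk => -[H1 H2 H3].
  have := HN k.+1 (leqW Nk) => -[_ H2' _].
  have X' : 0 <= m * X k.+1 by rewrite mulr_ge0// ltW.
  have t0 : 0 < t k by rewrite (lt_le_trans _ (t1 k)).
  have u0 : 0 < (t k)^-1 by rewrite invr_gt0.
  have v0 : 0 < (t k + 1)^-1 by rewrite invr_gt0; lra.
  have Xk := X0 k.
  have Ek : 0 <= E k by apply: le_trans H2; rewrite mulr_ge0// ltW.
  have XE : C / t k ^+ 2 * X k <= b / t k ^+ 2 * E k.
    have -> : C / t k ^+ 2 * X k = b / t k ^+ 2 * (m * X k).
      by rewrite /b; field; rewrite !gt_eqF.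
    by rewrite ler_wpM2l// divr_ge0// ltW// exprn_gt0.
  have g0 : 0 <= 2 * b / (t k + 1) by rewrite !mulr_ge0// ltW.
  have key : (1 + 2 * b / (t k + 1)) * (1 + b / t k ^+ 2) <= 1 + 2 * b / t k.
    rewrite -subr_ge0.
    have -> : 1 + 2 * b / t k - (1 + 2 * b / (t k + 1)) * (1 + b / t k ^+ 2)
       = b * (t k - (1 + 2 * b)) / (t k ^+ 2 * (t k + 1)).
      by field; rewrite !gt_eqF//; lra.
    apply: divr_ge0; first by apply: mulr_ge0 => //; lra.
    by apply: mulr_ge0; [exact: sqr_ge0 | lra].
  have keyE := ler_wpM2r Ek key.
  have E1 : E k.+1 <= (1 + b / t k ^+ 2) * E k - c * D k by lra.
  have E2 : (1 + 2 * b / (t k + 1)) * E k.+1 <=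
     (1 + 2 * b / (t k + 1)) * ((1 + b / t k ^+ 2) * E k - c * D k).
    by rewrite ler_wpM2l//; lra.
  have E3 : 0 <= 2 * b / (t k + 1) * (c * D k).
    by rewrite mulr_ge0// mulr_ge0// ltW.
  rewrite /W tS; lra.
exists N => // k1 /= Nk1 n k1n.
have WS : W n + c * \sum_(k1 <= i < n) D i <= W k1.
  elim: n k1n => [|n IH].
    by rewrite leqn0 => /eqP ->; rewrite big_geq// mulr0 addr0.
  rewrite leq_eqVlt => /predU1P[<-|]; first by rewrite big_geq// mulr0 addr0.
  rewrite ltnS => k1n; rewrite big_nat_recr//= mulrDr.
  have := Wstep n (leq_trans Nk1 k1n); have := IH k1n; lra.
have XW k : (N <= k)%N -> [/\ 0 <= E k, m * X k <= W k & W k <= (1 + 2 * b) * E k].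
  move=> Nk; have := HN k Nk => -[_ H2 _].
  have Ek : 0 <= E k by apply: le_trans H2; rewrite mulr_ge0// ltW.
  have t0 : 0 < t k by rewrite (lt_le_trans _ (t1 k)).
  have B0 : 0 <= 2 * b / t k by rewrite divr_ge0 ?mulr_ge0// ltW.
  have B1 : 2 * b / t k <= 2 * b by rewrite ler_pdivrMr// ler_peMr// mulr_ge0.
  have := mulr_ge0 B0 Ek; have := ler_wpM2r Ek B1.
  by rewrite /W => *; split; lra.
have [Ek1 _ Wk1] := XW k1 Nk1; have [En Xn _] := XW n (leq_trans Nk1 k1n).
have Xn0 := X0 n.
have sD : 0 <= \sum_(k1 <= i < n) D i by apply: sumr_ge0.
have mX : 0 <= m * X n by rewrite mulr_ge0// ltW.
have cS : 0 <= c * \sum_(k1 <= i < n) D i by rewrite mulr_ge0// ltW.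
have T1 : 0 <= c^-1 * ((1 + 2 * b) * E k1) by rewrite !mulr_ge0//; lra.
have T2 : 0 <= m^-1 * ((1 + 2 * b) * E k1) by rewrite !mulr_ge0//; lra.
have T3 : m^-1 * (m * X n) <= m^-1 * ((1 + 2 * b) * E k1).
  by rewrite ler_wpM2l ?(ltW mm0)//; lra.
have T4 : c^-1 * (c * \sum_(k1 <= i < n) D i) <= c^-1 * ((1 + 2 * b) * E k1).
  by rewrite ler_wpM2l ?(ltW cm0)//; lra.
rewrite mulrA mulVf ?mul1r in T3; last by rewrite gt_eqF.
rewrite mulrA mulVf ?mul1r in T4; last by rewrite gt_eqF.
by split; lra.
Unshelve. all: by end_near. Qed.

End Discount.

(** * The topology in terms of the inner product *)

Section EuclideanTopology.
Context {R : realType} {p : nat}.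
Implicit Types (a b u v : 'rV[R]_p) (eps : R).

Lemma sqr_coord_le u i : (u 0 i) ^+ 2 <= dot u u.
Proof.
rewrite /dot (bigD1 i)//= -expr2 lerDl.
by apply: sumr_ge0 => j _; exact: sqr_ge0.
Qed.

Lemma nbhs_dot a eps : 0 < eps -> nbhs a [set v | dot (v - a) (v - a) < eps].
Proof.
move=> e0; pose de := Num.min 1 (eps / (p%:R + 1)).
have p1 : 0 < p%:R + 1 :> R by apply: ltr_wpDl.
have de0 : 0 < de by rewrite lt_min ltr01 divr_gt0.
apply/nbhs_ballP; exists de => // v [_ av] /=.
have de1 : de <= 1 by rewrite ge_min lexx.
have de2 : de * (p%:R + 1) <= eps by rewrite -ler_pdivlMr// ge_min lexx orbT.
apply: (@le_lt_trans _ _ (\sum_(i < p) de)).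
  apply: ler_sum => i _; rewrite !mxE -expr2.
  have := av 0 i; rewrite /ball/= distrC => /ltW ad.
  rewrite -real_normK ?num_real// expr2.
  apply: (@le_trans _ _ (`|v 0 i - a 0 i| * 1)); last by rewrite mulr1.
  by rewrite ler_wpM2l// (le_trans ad).
rewrite sumr_const card_ord -[_ *+ _]mulr_natr; lra.
Qed.

Lemma nbhs_dot_sub a (A : set 'rV[R]_p) : nbhs a A ->
  exists2 eps, 0 < eps & forall v, dot (v - a) (v - a) < eps -> A v.
Proof.
move=> /nbhs_ballP[e /= e0 eA]; exists (e ^+ 2); first by rewrite exprn_gt0.
move=> v ve; apply: eA; split=> // i j; rewrite (ord1 i) /ball/= distrC.
rewrite -(ltr_pXn2r (_ : 0 < 2)%N) ?nnegrE ?(ltW e0)// real_normK ?num_real//.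
by apply: le_lt_trans ve; have := sqr_coord_le (v - a) j; rewrite !mxE.
Qed.

Lemma cvg_dot (x : nat -> 'rV[R]_p) a :
  (forall eps, 0 < eps -> \forall k \near \oo, dot (x k - a) (x k - a) < eps) ->
  x @ \oo --> a.
Proof.
move=> xa A /nbhs_dot_sub[eps e0 eA]; apply: filterS (xa _ e0) => k; exact: eA.
Qed.

Lemma closed_dot_approx (G : set ('rV[R]_p * 'rV[R]_p)) a b : closed G ->
  (forall eps, 0 < eps -> exists u v,
     [/\ G (u, v), dot (u - a) (u - a) < eps & dot (v - b) (v - b) < eps]) ->
  G (a, b).
Proof.
move=> clG app; apply: clG => B [[P Q] /= [aP bQ] PQB].
have [e1 e10 e1P] := nbhs_dot_sub aP; have [e2 e20 e2Q] := nbhs_dot_sub bQ.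
have [|u [v [Guv ua vb]]] := app (Num.min e1 e2); first by rewrite lt_min e10.
exists (u, v); split=> //; apply: PQB; split=> /=.
  by apply: e1P; apply: lt_le_trans ua _; rewrite ge_min lexx.
by apply: e2Q; apply: lt_le_trans vb _; rewrite ge_min lexx orbT.
Qed.

Lemma bounded_cluster (x : nat -> 'rV[R]_p) B :
  (forall k, dot (x k) (x k) <= B) ->
  exists a, forall eps N, 0 < eps ->
    exists2 k, (N <= k)%N & dot (x k - a) (x k - a) < eps.
Proof.
move=> xB; have B0 : 0 <= B by rewrite (le_trans _ (xB 0%N)) ?dot_ge0.
have cK : compact [set v : 'rV[R]_p | forall i, `[- (B + 1), B + 1]%classic (v ord0 i)].
  by apply: (@rV_compact _ _ (fun=> `[- (B + 1), B + 1]%classic)) => _;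
     exact: segment_compact.
have xK : (x @ \oo) [set v : 'rV[R]_p | forall i, `[- (B + 1), B + 1]%classic (v ord0 i)].
  exists 0%N => // k _ i /=; rewrite in_itv/= -ler_norml.
  rewrite -(ler_pXn2r (_ : 0 < 2)%N) ?nnegrE ?addr_ge0// real_normK ?num_real//.
  apply: le_trans (sqr_coord_le _ _) _; apply: le_trans (xB k) _.
  by have := sqr_ge0 B; lra.
have [a [_ aC]] := cK (x @ \oo) _ xK.
exists a => eps N e0.
have [|v [[k Nk <-] ka]] := aC [set x k | k in [set k | (N <= k)%N]] _ _ (nbhs_dot a e0).
  by exists N => // k Nk; exists k.
by exists k.
Qed.

End EuclideanTopology.

(** * Stability and convergence *)

Section Harmonic.
Context {R : realType}.

Lemma harmonic_sum_unbounded (B : R) N :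
  exists n, B < \sum_(N <= i < n) harmonic i.
Proof.
apply: contrapT => nB; apply: (@dvg_harmonic R).
have H0 i : 0 <= harmonic i :> R by rewrite /harmonic invr_ge0.
apply: nondecreasing_is_cvgn.
  by apply/nondecreasing_seqP => n; rewrite /series/= big_nat_recr//= lerDl.
exists (\sum_(0 <= i < N) harmonic i + B) => _ [n _ <-]; rewrite /series/=.
have BN m : \sum_(N <= i < m) harmonic i <= B.
  by rewrite leNgt; apply/negP => mB; apply: nB; exists m.
have [Nn|nN] := leqP N n.
  by rewrite (big_cat_nat (leq0n N) Nn)//= lerD2l BN.
rewrite [in leRHS](big_cat_nat (leq0n n) (ltnW nN))//= -addrA lerDl addr_ge0 ?sumr_ge0//.
by have := BN N; rewrite big_geq.
Qed.

(** Otherwise D would dominate a multiple of 1 / t, hence of the harmonic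
    series. *)
Lemma summable_liminf (t D : nat -> R) B N :
  (forall k, 1 <= t k) -> (forall k, t k.+1 = t k + 1) ->
  (forall n, \sum_(N <= i < n) D i <= B) ->
  forall eps, 0 < eps -> exists2 k, (N <= k)%N & t k * D k < eps.
Proof.
move=> t1 tS DB eps e0; apply: contrapT => nk.
have c0 : 0 < eps / t 0%N by rewrite divr_gt0// (lt_le_trans _ (t1 0%N)).
have tE k : t k <= t 0%N * k.+1%:R.
  elim: k => [|k IH]; first by rewrite mulr1.
  by rewrite tS -natr1 mulrDr mulr1 lerD.
have big k : (N <= k)%N -> eps / t 0%N * harmonic k <= D k.
  move=> Nk; have tk : 0 < t k by rewrite (lt_le_trans _ (t1 k)).
  have : eps <= t k * D k by rewrite leNgt; apply/negP => ?; apply: nk; exists k.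
  rewrite -ler_pdivrMl// => /(le_trans _); apply.
  rewrite /harmonic/= -mulrA [_^-1 * eps]mulrC ler_wpM2l ?(ltW e0)// -invfM.
  by rewrite lef_pV2 ?posrE// mulr_gt0// (lt_le_trans _ (t1 0%N)).
have [n Bn] := harmonic_sum_unbounded (B / (eps / t 0%N)) N.
have : eps / t 0%N * \sum_(N <= i < n) harmonic i <= B.
  apply: le_trans (DB n); rewrite mulr_sumr big_nat_cond [leRHS]big_nat_cond.
  by apply: ler_sum => i /andP[/andP[Ni _] _]; exact: big.
by rewrite -ler_pdivlMl// mulrC leNgt Bn.
Qed.

End Harmonic.

Section Convergence.
Context {R : realType} {p : nat}.
Variables (r mu sigma beta rho a2 c2 : R) (t : nat -> R).
Variables (x q z w d : nat -> 'rV[R]_p).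
Hypotheses (r2 : 2 < r) (mu1 : 1 < mu) (sigma0 : 0 < sigma).
Hypotheses (rho0 : 0 <= rho) (rho_beta : 8 * rho <= beta).
Hypotheses (a20 : 0 <= a2) (c20 : 0 <= c2) (ac : 4 * a2 + 18 * c2 <= 1).
Hypothesis sys : inertial_system r mu sigma beta rho a2 c2 t x q z w d.

Let D := dissipation t x z d.

(** What the energy measures besides the distance to a zero, up to constants. *)
Definition tension (k : nat) : R :=
  dot (q k) (q k) + t k ^+ 2 * (dot (z k) (z k) + dot (d k) (d k)).

Lemma tension_ge0 k : 0 <= tension k.
Proof. by rewrite addr_ge0 ?dot_ge0// mulr_ge0 ?sqr_ge0// addr_ge0 ?dot_ge0. Qed.

Lemma tension_dissipation : exists2 M, 0 < M & forall k, tension k <= M * (t k * D k).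
Proof.
have sys' := sys.
pose et := (mu + 1) * sigma + beta.
have e0 := sqr_ge0 et.
exists (2 + 2 * et ^+ 2); first by lra.
move=> k; have t1 := is_t1 sys k.
rewrite /tension /D /dissipation (is_q sys k) -/et !(dotZl, dotZr).
have V := dot_sqrD (x k.+1 - x k) (et *: d k.+1).
rewrite !(dotZl et, dotZr et) in V.
have t2 : 0 <= t k ^+ 2 by rewrite sqr_ge0.
have t3 : t k ^+ 2 <= t k ^+ 3 by rewrite ler_weXn2l.
have Px := mulr_ge0 t2 (dot_ge0 (x k.+1 - x k)).
have Pz := mulr_ge0 t2 (dot_ge0 (z k)).
have Pd := ler_wpM2r (dot_ge0 (d k)) t3.
have Pd' := ler_wpM2r (dot_ge0 (d k.+1)) t3.
have Pd0 := mulr_ge0 t2 (dot_ge0 (d k)).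
have Pd0' := mulr_ge0 t2 (dot_ge0 (d k.+1)).
have V' := ler_wpM2l t2 V.
have Q1 := mulr_ge0 e0 Px; have Q2 := mulr_ge0 e0 Pz.
have Q3 := ler_wpM2l e0 Pd; have Q3' := ler_wpM2l e0 Pd'.
have Q4 := mulr_ge0 e0 Pd0.
lra.
Qed.

(** From some rank on, the energy at one single time controls the distance to
    xs at all later times.  Applied at a time when x is close to xs and the
    tension is small, this forces convergence. *)
Lemma stability (xs : 'rV[R]_p) :
  (forall k, - rho * dot (w k) (w k) <= dot (x k - xs) (w k)) ->
  exists2 M, 0 < M & \forall k1 \near \oo, forall n, (k1 <= n)%N ->
    let B := M * (dot (x k1 - xs) (x k1 - xs) + tension k1) in
    dot (x n - xs) (x n - xs) <= B /\ \sum_(k1 <= i < n) D i <= B.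
Proof.
move=> xw.
have [hr hm hs] := And3 r2 mu1 sigma0; have [h0 hb hac] := And3 rho0 rho_beta ac.
have [ha hc] := conj a20 c20.
have t1 := is_t1 sys; have tS := is_tS sys.
have be0 : 0 <= beta by lra.
have [om0 s0 et0 _ b0] := params_gt0 hr hm hs be0.
set om := mu * sigma in om0 *; set s := (mu + 1) * sigma in s0 *.
set et := _ * _ + beta in et0 *.
set b := _ + _ in b0 *.
have [c c0 [C C0 dsc]] := lyapunov_descent r2 mu1 sigma0 rho0 rho_beta ac sys xw.
have coe : \forall k \near \oo, r * mu / 2 * dot (x k - xs) (x k - xs) <=
    lyapunov r mu sigma beta a2 t x q z w d xs k.
  near=> k.
  have := @energy_coercive R p r mu sigma beta (1 / 4 - a2 / 2) rho c2 (t k)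
    (x k - xs) (q k) (z k) (w k - z k) (d k).
  rewrite [z k + _]addrC subrK; apply => //.
  - lra.
  - exact: (is_inexact sys k).
  - have : b / sigma <= t k by near: k; exact: t_unbounded.
    by rewrite ler_pdivrMr// mulrC.
  - have : (b * s + 2 * om * r * rho) / (sigma ^+ 2 / 4) <= t k.
      by near: k; exact: t_unbounded.
    by rewrite ler_pdivrMr ?divr_gt0 ?exprn_gt0// [leRHS]mulrC.
  - have : (2 * r * rho) / (3 * et) <= t k by near: k; exact: t_unbounded.
    by rewrite ler_pdivrMr ?mulr_gt0// [leRHS]mulrC.
have m0 : 0 < r * mu / 2 by rewrite !mulr_gt0//; lra.
have [M M0 stab] := discounted_descent t1 tS c0 C0 m0
  (dissipation_ge0 sys) dsc coe (fun k => dot_ge0 _).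
pose K := 1 / 4 - a2 / 2.
pose M1 := (2 * r ^+ 2 + r * mu) + (2 + om) + ((s + b) ^+ 2 + om)
   + (om * `|c2| + om * et * K).
have K0 : 0 <= K by rewrite /K; lra.
have [i1 i2 i3 i4] : [/\ 0 <= 2 * r ^+ 2 + r * mu, 0 <= 2 + om,
    0 <= (s + b) ^+ 2 + om & 0 <= om * `|c2| + om * et * K].
  split; [|lra| |].
  - have := sqr_ge0 r; have : 0 <= r * mu by rewrite mulr_ge0//; lra.
    lra.
  - by have := sqr_ge0 (s + b); lra.
  - apply: addr_ge0; apply: mulr_ge0 => //; first exact: ltW.
    by apply: mulr_ge0; exact: ltW.
exists (M * M1).
  apply: mulr_gt0 => //; rewrite /M1; lra.
apply: filterS stab => k stab n kn /=.
have [S1 S2] := stab n kn.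
have : M * lyapunov r mu sigma beta a2 t x q z w d xs k <=
    M * M1 * (dot (x k - xs) (x k - xs) + tension k).
  rewrite -mulrA ler_wpM2l ?(ltW M0)//.
  have := @energy_bounded R p r mu sigma beta K c2 (t k)
    (x k - xs) (q k) (z k) (w k - z k) (d k) hr hm hs be0 K0 (t1 k) (is_inexact sys k).
  rewrite [z k + _]addrC subrK => /le_trans; apply.
  rewrite -/om -/s -/et -/b /tension [t k ^+ 2 * (_ + _)]mulrDr.
  have t2 := sqr_ge0 (t k).
  have j1 := dot_ge0 (x k - xs); have j2 := dot_ge0 (q k).
  have j3 := mulr_ge0 t2 (dot_ge0 (z k)); have j4 := mulr_ge0 t2 (dot_ge0 (d k)).
  rewrite /M1; move: i1 i2 i3 i4 j1 j2 j3 j4.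
  move: (_ + r * mu) (2 + om) (_ + om) (_ + om * et * K) (dot (x k - xs) _) (dot (q k) _).
  move: (t k ^+ 2 * dot (z k) _) (t k ^+ 2 * dot (d k) _).
  move=> Z E A1 A2 A3 A4 X Q i1 i2 i3 i4 j1 j2 j3 j4.
  have := mulr_ge0 i1 j2; have := mulr_ge0 i1 j3; have := mulr_ge0 i1 j4.
  have := mulr_ge0 i2 j1; have := mulr_ge0 i2 j3; have := mulr_ge0 i2 j4.
  have := mulr_ge0 i3 j1; have := mulr_ge0 i3 j2; have := mulr_ge0 i3 j4.
  have := mulr_ge0 i4 j1; have := mulr_ge0 i4 j2; have := mulr_ge0 i4 j3.
  lra.
by move=> L; split; lra.
Unshelve. all: by end_near. Qed.

(** Any zero gives boundedness and a summable dissipation, hence times along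
    which the tension vanishes.  A cluster point a of x along these times is in
    S, and stability with respect to a itself concludes. *)
Lemma convergence (S : set 'rV[R]_p) : S !=set0 ->
  (forall xs, S xs -> forall k, - rho * dot (w k) (w k) <= dot (x k - xs) (w k)) ->
  (forall a, (forall eps, 0 < eps -> exists k,
     dot (x k - a) (x k - a) < eps /\ dot (w k) (w k) < eps) -> S a) ->
  exists xs, [/\ S xs, x @ \oo --> xs &
    (fun k => x k.+1 - x k + ((mu + 1) * sigma + beta) *: d k.+1 : 'rV[R]_p) @ \oo
      --> (0 : 'rV[R]_p)].
Proof.
move=> [xs0 S0] Smono Sclosed.
have t1 := is_t1 sys; have tS := is_tS sys; have D0 := dissipation_ge0 sys.
have hc := c20.
have [M M0 [N0 _ stab]] := stability (Smono _ S0).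
have liminf i : exists k, (N0 + i <= k)%N /\ tension k < i.+1%:R^-1.
  have [M1 M10 tD] := tension_dissipation.
  have SB n : \sum_((N0 + i)%N <= j < n) D j <=
      M * (dot (x (N0 + i)%N - xs0) (x (N0 + i)%N - xs0) + tension (N0 + i)%N).
    have [Nn|nN] := leqP (N0 + i) n.
      by have [] := stab (N0 + i)%N (leq_addr _ _) n Nn.
    rewrite big_geq ?(ltnW nN)// mulr_ge0 ?(ltW M0)// addr_ge0 ?dot_ge0//.
    exact: tension_ge0.
  have e0 : 0 < (i.+1%:R * M1)^-1 :> R by rewrite invr_gt0 mulr_gt0.
  have [k Nk tDk] := summable_liminf t1 tS SB e0.
  exists k; split=> //; apply: le_lt_trans (tD k) _.
  by rewrite -ltr_pdivlMl// -invfM [M1 * _]mulrC.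
have [phi phiP] := choice liminf.
have xB i : dot (x (phi i)) (x (phi i)) <=
    2 * (M * (dot (x N0 - xs0) (x N0 - xs0) + tension N0)) + 2 * dot xs0 xs0.
  have [Ni _] := phiP i.
  have [B1 _] := stab N0 (leqnn _) (phi i) (leq_trans (leq_addr _ _) Ni).
  have := dot_sqrD (x (phi i) - xs0) xs0; rewrite subrK; lra.
have [a aP] := bounded_cluster xB.
have near_a eps N : 0 < eps -> exists k, [/\ (N <= k)%N,
    dot (x k - a) (x k - a) < eps & tension k < eps].
  move=> e0.
  have [m _ mP] : \forall m \near \oo, (m.+1%:R^-1 : R) < eps.
    exact: near_infty_natSinv_lt (PosNum e0).
  have [i Ni xi] := aP eps (maxn N m) e0; exists (phi i); have [Ni' ti] := phiP i.
  split=> //.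
    by apply: leq_trans Ni'; rewrite (leq_trans _ (leq_addl _ _))// (leq_trans _ Ni)// leq_maxl.
  by apply: lt_trans ti _; apply: mP; rewrite /= (leq_trans _ Ni)// leq_maxr.
have Sa : S a.
  apply: Sclosed => eps e0.
  have [|k [_ xk tk]] := near_a (eps / (2 + 2 * c2)) 0%N; first by rewrite divr_gt0//; lra.
  have ec : eps / (2 + 2 * c2) <= eps.
    by rewrite ler_pdivrMr ?ler_peMr ?(ltW e0)//; lra.
  exists k; split; first exact: lt_le_trans ec.
  rewrite ltr_pdivlMr in tk; last lra.
  apply: le_lt_trans tk.
  have := dot_sqrD (z k) (w k - z k); rewrite [z k + _]addrC subrK => V.
  have E := is_inexact sys k.
  have t2 : 1 <= t k ^+ 2 by rewrite exprn_ege1.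
  have T : dot (z k) (z k) + dot (d k) (d k) <= tension k.
    rewrite /tension -[leLHS]add0r lerD ?dot_ge0// ler_peMl// addr_ge0 ?dot_ge0//.
  have Z0 := dot_ge0 (z k); have d0 := dot_ge0 (d k).
  have c0 : 0 <= 2 + 2 * c2 by lra.
  have := ler_wpM2r c0 T; have := mulr_ge0 hc Z0; rewrite /= in E; lra.
have [M' M'0 stab'] := stability (Smono _ Sa).
have small eps : 0 < eps -> \forall n \near \oo, dot (x n - a) (x n - a) < eps /\ D n < eps.
  move=> e0; have [N1 _ stab1] := stab'.
  have [|k [Nk xk tk]] := near_a (eps / (2 * M')) N1; first by rewrite divr_gt0// mulr_gt0.
  have B : M' * (dot (x k - a) (x k - a) + tension k) < eps.
    rewrite ltr_pdivlMr in xk; last by rewrite mulr_gt0.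
    rewrite ltr_pdivlMr in tk; last by rewrite mulr_gt0.
    lra.
  exists k => // n /= kn; have [B1 _] := stab1 k Nk n kn.
  have [_ B2] := stab1 k Nk n.+1 (leqW kn).
  split; first exact: le_lt_trans B.
  apply: le_lt_trans B; apply: le_trans B2.
  by rewrite big_nat_recr//= lerDr sumr_ge0.
exists a; split=> //; first by apply: cvg_dot => eps /small; apply: filterS => n [].
apply: cvg_dot => eps e0; set et := _ + beta.
have et2 := sqr_ge0 et.
have e1 : 0 < eps / (2 + 2 * et ^+ 2) by rewrite divr_gt0//; lra.
apply: filterS (small _ e1) => n [_].
rewrite ltr_pdivlMr; last lra.
apply: le_lt_trans; rewrite subr0.
have := dot_sqrD (x n.+1 - x n) (et *: d n.+1); rewrite !(dotZl et, dotZr et).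
have tn := t1 n; have t2 : 1 <= t n ^+ 2 by rewrite exprn_ege1.
have X0 := dot_ge0 (x n.+1 - x n); have d0 := dot_ge0 (d n.+1).
have Dn : dot (x n.+1 - x n) (x n.+1 - x n) + dot (d n.+1) (d n.+1) <= D n.
  rewrite /D /dissipation [leLHS]addrC lerD//.
    apply: le_trans (_ : dot (d n.+1) (d n.+1) + dot (d n) (d n) <= _).
      by rewrite lerDl dot_ge0.
    by rewrite ler_peMl// addr_ge0 ?dot_ge0.
  apply: le_trans (_ : dot (x n.+1 - x n) (x n.+1 - x n) + dot (z n) (z n) <= _).
    by rewrite lerDl dot_ge0.
  by rewrite ler_peMl// addr_ge0 ?dot_ge0.
have E0 : 0 <= 2 + 2 * et ^+ 2 by lra.
have := ler_wpM2r E0 Dn; have := mulr_ge0 et2 X0; have := mulr_ge0 et2 d0.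
lra.
Qed.

End Convergence.

(** * The extragradient scheme *)

Lemma Lipschitz_dot (R : realType) (p : nat) (F : 'rV[R]_p -> 'rV[R]_p) L :
  0 <= L -> Lipschitz L F ->
  forall x y, dot (F x - F y) (F x - F y) <= L ^+ 2 * dot (x - y) (x - y).
Proof.
move=> L0 FL x y; rewrite -!sqr_enorm -exprMn lerXn2r ?nnegrE//.
- exact: sqrtr_ge0.
- by rewrite mulr_ge0// sqrtr_ge0.
Qed.

(** How the step-size restriction is used: 12 + 3 r + epsh >= 18, and the
    bracket in [Psi] lies in (0, 1], so that its square is at most itself. *)
Lemma step_size_bound (R : realType) (L eta r epsh kappa kappah : R) :
  0 <= L -> 0 <= eta -> 2 < r -> 0 <= epsh -> 0 <= kappa -> 0 <= kappah ->
  kappah < (3 * r - 1) / (3 * r * (12 + 3 * r + epsh)) ->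
  (eta%:E < (Psi r epsh kappa kappah)%:E / L%:E)%E ->
  4 * (L * eta) ^+ 2 + 18 * (kappa * (L * eta) ^+ 2 + kappah) <= 1.
Proof.
move=> L0 eta0 r2 eh0 k0 kh0 kh1 etaPsi.
set a2 := (L * eta) ^+ 2; have a20 : 0 <= a2 by exact: sqr_ge0.
set Q := 12 + 3 * r + epsh in kh1; have Q18 : 18 <= Q by rewrite /Q; lra.
set b := 1 - 1 / (3 * r) - kappah * Q.
have r3 : 0 < 3 * r by lra.
have ir : 0 < 1 / (3 * r) by rewrite divr_gt0.
have b0 : 0 < b.
  rewrite /b subr_gt0.
  have : kappah * Q < (3 * r - 1) / (3 * r * Q) * Q by rewrite ltr_pM2r//; lra.
  congr (_ < _); field; rewrite !gt_eqF//; lra.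
have kQ : 0 <= kappah * Q by rewrite mulr_ge0//; lra.
have b1 : b <= 1 by rewrite /b; lra.
pose S := 4 + 12 * kappa + 3 * kappa * r + kappa * epsh.
have S0 : 0 < S.
  have : 0 <= 3 * kappa * r by rewrite !mulr_ge0//; lra.
  have : 0 <= kappa * epsh by rewrite mulr_ge0.
  rewrite /S; lra.
have aS : a2 * S <= b.
  move: L0; rewrite le_eqVlt => /predU1P[L0|L0].
    by rewrite /a2 -L0 mul0r expr0n mul0r ltW.
  have LP : L * eta < Psi r epsh kappa kappah.
    by move: etaPsi; rewrite inver gt_eqF// -EFinM lte_fin ltr_pdivlMr// mulrC.
  have sS : 0 < Num.sqrt S by rewrite sqrtr_gt0.
  have LS : L * eta * Num.sqrt S < b.
    rewrite -ltr_pdivlMr//; apply: lt_le_trans LP _.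
    by rewrite /Psi -/S -/Q -/b mul1r mulrC.
  have LS0 : 0 <= L * eta * Num.sqrt S by rewrite !mulr_ge0// ltW.
  have -> : a2 * S = (L * eta * Num.sqrt S) ^+ 2 by rewrite exprMn sqr_sqrtr// ltW.
  apply: (@le_trans _ _ (b ^+ 2)); first by rewrite lerXn2r ?nnegrE// ltW.
  by rewrite expr2 ger_pMl.
have c20 : 0 <= kappa * a2 + kappah by rewrite addr_ge0// mulr_ge0.
have := ler_wpM2l c20 Q18.
have : 4 * a2 + (kappa * a2 + kappah) * Q <= 1 - 1 / (3 * r).
  by move: aS; rewrite /S /b /Q; lra.
lra.
Qed.

Section SchemeSystem.
Context {R : realType} {p : nat}.
Variables (F : 'rV[R]_p -> 'rV[R]_p) (T : 'rV[R]_p -> set 'rV[R]_p).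
Variables (rho L r mu sigma kappa kappah beta : R).
Variables (t : nat -> R) (x y u xi : nat -> 'rV[R]_p).

(** The indices start at 1 because the bound on u does, and because the
    direction that led to x 0 does not exist. *)
Lemma GAEGp_inertial : let eta := (mu + 1) * sigma + beta in
  co_hypomonotone rho (opsum F T) -> 0 <= L -> Lipschitz L F ->
  0 < mu -> 0 < eta -> 0 <= kappa ->
  (forall k, 1 <= t k) -> (forall k, t k.+1 = t k + 1) ->
  GAEGp r mu eta beta t F T x y u xi ->
  (forall k, (1 <= k)%N ->
    enorm (F (x k) - u k) ^+ 2 <=
      kappa * enorm (F (x k) - F (y k.-1)) ^+ 2
      + kappah * enorm (ddir r t F y u xi k.-1) ^+ 2) ->
  inertial_system r mu sigma beta rho ((L * eta) ^+ 2)
    (kappa * (L * eta) ^+ 2 + kappah) (fun k => t k.+1) (fun k => x k.+1)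
    (fun k => t k.+1 *: (y k.+1 - x k.+1)) (fun k => zdir u xi k.+1)
    (fun k => F (x k.+1) + xi k.+1) (ddir r t F y u xi).
Proof.
move=> eta hPhi L0 hF mu0 eta0 k0 t1 tS G hu.
have en0 : eta != 0 by rewrite gt_eqF.
have mu10 : mu + 1 != 0 by rewrite gt_eqF//; lra.
have xS k := GAEGp_xS k en0 G.
have yE k : y k = x k.+1 + eta *: ddir r t F y u xi k by rewrite xS subrK.
have Fd k : dot (F (x k.+1) - F (y k)) (F (x k.+1) - F (y k)) <=
    (L * eta) ^+ 2 * dot (ddir r t F y u xi k) (ddir r t F y u xi k).
  apply: le_trans (Lipschitz_dot L0 hF _ _) _.
  rewrite [x k.+1 - _](_ : _ = - (eta *: ddir r t F y u xi k)); last first.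
    by rewrite [y k]yE opprD addrA subrr sub0r.
  by rewrite !dotE exprMn le_eqVlt; apply/orP; left; apply/eqP; ring.
split=> //=.
- by move=> k; rewrite {1}yE addrAC.
- move=> k.
  have tk0 : t k.+1 != 0 by rewrite gt_eqF// (lt_le_trans _ (t1 _)).
  have tk1 : t k.+1 + 1 != 0 by rewrite gt_eqF//; have := t1 k.+1; lra.
  have wE : what F y xi k.+2 = ddir r t F y u xi k.+1 + gamma_at r (t k.+1) *: zdir u xi k.+1.
    by rewrite /ddir subrK.
  rewrite (GAEGp_y G k.+1) /pdir wE (tS k.+1) [y k.+1]yE.
  move: (ddir _ _ _ _ _ _ _) (zdir _ _ k.+1) (zdir _ _ k.+2) (x k.+1) (x k.+2).
  move=> dd z1 z2 x1 x2.
  rewrite /theta_at /gamma_at /eta_at /lambda_at /nu_at /delta /eta.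
  apply/rowP => i; rewrite !mxE; field.
  by rewrite tk1 tk0.
- move=> k; apply: le_trans (Fd k.+1).
  rewrite le_eqVlt; apply/orP; left; apply/eqP.
  have -> : F (x k.+2) + xi k.+2 - ddir r t F y u xi k.+1
       - (1 - (r - 1) / t k.+1) *: zdir u xi k.+1 = F (x k.+2) - F (y k.+1).
    have -> : 1 - (r - 1) / t k.+1 = gamma_at r (t k.+1).
      by rewrite /gamma_at; field; rewrite gt_eqF// (lt_le_trans _ (t1 _)).
    by rewrite /ddir /what /=; apply/rowP => i; rewrite !mxE; ring.
  by [].
- move=> k.
  have -> : F (x k.+1) + xi k.+1 - zdir u xi k.+1 = F (x k.+1) - u k.+1.
    by rewrite /zdir opprD addrACA subrr addr0.
  have := hu k.+1 isT; rewrite !sqr_enorm => /= H.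
  apply: le_trans H _; rewrite mulrDl lerD2r -mulrA ler_wpM2l//.
- move=> k; rewrite -sqr_enorm; apply: hPhi.
  + by exists (xi k.+2) => //; exact: GAEGp_xiS en0 G.
  + by exists (xi k.+1) => //; exact: GAEGp_xiS en0 G.
Qed.

End SchemeSystem.

Theorem theorem7p6 (R : realType) (p : nat)
  (F : 'rV[R]_p -> 'rV[R]_p) (T : 'rV[R]_p -> set 'rV[R]_p)
  (rho L r mu eps epsh kappa kappah eta beta : R)
  (t : nat -> R) (x y u xi : nat -> 'rV[R]_p)
  (hzer : zer (opsum F T) !=set0)
  (hrho : 0 <= rho)
  (hPhi : co_hypomonotone rho (opsum F T))
  (hL : 0 <= L)
  (hF : Lipschitz L F)
  (hr : 2 < r)
  (hmu : 1 < mu)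
  (heps : 0 <= eps)
  (hepsh : 0 <= epsh)
  (hkappa : 0 <= kappa)
  (hkappah0 : 0 <= kappah)
  (hkappah1 : kappah < (3 * r - 1) / (3 * r * (12 + 3 * r + epsh)))
  (hLrho : L * rho < (r - 2) * Psi r epsh kappa kappah / (8 * (r + mu - 1)))
  (hbeta : beta = 8 * rho + 2 * eps)
  (hbeta_eta : beta < eta)
  (heta0 : (r + mu - 1) * beta / (r - 2) <= eta)
  (* extended-real quotient, so that the bound is +oo when L = 0 *)
  (heta1 : (eta%:E < (Psi r epsh kappa kappah)%:E / L%:E)%E)
  (ht : forall k, t k = k%:R + t0 rho r mu epsh eta beta)
  (hJ : is_map (resolvent eta T))
  (hG : GAEGp r mu eta beta t F T x y u xi)
  (hu : forall k, (1 <= k)%N ->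
    enorm (F (x k) - u k) ^+ 2 <=
      kappa * enorm (F (x k) - F (y k.-1)) ^+ 2
      + kappah * enorm (ddir r t F y u xi k.-1) ^+ 2)
  (hT : closed (gra T)) :
  exists xs : 'rV[R]_p,
    [/\ zer (opsum F T) xs, x @ \oo --> xs & y @ \oo --> xs].
Proof.
have eta0 : 0 < eta by lra.
have t1 k : 1 <= t k.
  have : r <= t0 rho r mu epsh eta beta by rewrite /t0 !le_max lexx !orbT.
  by have := ler0n R k; rewrite ht; lra.
have tS k : t k.+1 = t k + 1 by rewrite !ht -natr1; ring.
have etaE : eta = (mu + 1) * ((eta - beta) / (mu + 1)) + beta.
  by field; rewrite gt_eqF//; lra.
have [sigma sigmaE] : exists sigma, sigma = (eta - beta) / (mu + 1) by eexists.
have sigma0 : 0 < sigma by rewrite sigmaE divr_gt0//; lra.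
have rho_beta : 8 * rho <= beta by lra.
have a20 := sqr_ge0 (L * eta).
have c20 : 0 <= kappa * (L * eta) ^+ 2 + kappah by rewrite addr_ge0// mulr_ge0.
have ac := step_size_bound hL (ltW eta0) hr hepsh hkappa hkappah0 hkappah1 heta1.
have en0 : eta != 0 by rewrite gt_eqF.
rewrite -sigmaE in etaE; rewrite {}etaE {sigmaE} in eta0 hG hu a20 c20 ac en0.
have sys := GAEGp_inertial hPhi hL hF (lt_trans ltr01 hmu) eta0 hkappa t1 tS hG hu.
have Txi k : T (x k.+1) (xi k.+1) by exact: GAEGp_xiS en0 hG.
have zmono xs : zer (opsum F T) xs -> forall k,
    - rho * dot (F (x k.+1) + xi k.+1) (F (x k.+1) + xi k.+1) <=
    dot (x k.+1 - xs) (F (x k.+1) + xi k.+1).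
  move=> zxs k; rewrite [leRHS]dotC -sqr_enorm -[F _ + _]subr0.
  by apply: hPhi; [exists (xi k.+1) => //; exact: Txi | exact: zxs].
have zclosed a : (forall e, 0 < e -> exists k,
    dot (x k.+1 - a) (x k.+1 - a) < e /\
    dot (F (x k.+1) + xi k.+1) (F (x k.+1) + xi k.+1) < e) -> zer (opsum F T) a.
  move=> app; exists (- F a); last by rewrite subrr.
  apply: (closed_dot_approx hT) => e e0.
  have L20 := sqr_ge0 L.
  have c0 : 0 < 2 + 2 * L ^+ 2 by lra.
  have [|k [xk wk]] := app (e / (2 + 2 * L ^+ 2)); first by rewrite divr_gt0.
  exists (x k.+1), (xi k.+1); split; first exact: Txi.
    by apply: lt_le_trans xk _; rewrite ler_pdivrMr// ler_peMr ?(ltW e0)//; lra.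
  have ee : (2 + 2 * L ^+ 2) * (e / (2 + 2 * L ^+ 2)) = e by field; rewrite gt_eqF.
  have := ler_wpM2l L20 (ltW xk).
  move: (e / _) ee xk wk => e' ee xk wk.
  have -> : xi k.+1 - - F a = F (x k.+1) + xi k.+1 + - (F (x k.+1) - F a).
    by apply/rowP => i; rewrite !mxE; ring.
  have := dot_sqrD (F (x k.+1) + xi k.+1) (- (F (x k.+1) - F a)).
  rewrite [dot (- _) _]dotNl [dot _ (- (F (x k.+1) - F a))]dotNr opprK.
  have := Lipschitz_dot hL hF (x k.+1) a.
  lra.
have [xs [zxs xcvg ycvg]] := convergence hr hmu sigma0 hrho rho_beta a20 c20 ac sys
  hzer zmono zclosed.
exists xs; split=> //; first by rewrite -(cvg_shiftS x).
rewrite -(cvg_shiftS y).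
have yE : (fun k => y k.+1) = (fun k => x k.+1) \+
    (fun k => x k.+2 - x k.+1 + ((mu + 1) * sigma + beta) *: ddir r t F y u xi k.+1).
  apply/funext => k /=.
  by rewrite (GAEGp_xS k.+1 en0 hG); apply/rowP => i; rewrite !mxE; ring.
by rewrite yE -[xs]addr0; exact: cvgD xcvg ycvg.
Qed.
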